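(* Let $k$ be an algebraically closed field, $n\geq 2$, and let $\mathrm{Bir}(\mathbb{P}_k^n)$ be the group of birational maps of the projective space $\mathbb{P}_k^n$. Any length function $l:\mathrm{Bir}(\mathbb{P}_k^n)\to[0,+\infty)$ vanishes on the automorphism group $\mathrm{Aut}(\mathbb{P}_k^n)=\mathrm{PGL}_{n+1}(k)$.
   Context: A function $l:G\to[0,\infty)$ on a group $G$ is a length function if (1) $l(g^n)=|n|\,l(g)$ for all $g\in G$, $n\in\mathbb{Z}$; (2) $l(hgh^{-1})=l(g)$ for all $g,h\in G$; (3) $l(ab)\le l(a)+l(b)$ for all commuting elements $a,b\in G$. $\mathrm{Bir}(\mathbb{P}_k^n)$ (the Cremona group) is the group of birational self-maps of $\mathbb{P}_k^n$ defined over $k$. *)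

(* Defs.v *)
From HB Require Import structures.
From mathcomp Require Import all_boot all_order all_algebra.
From mathcomp Require Import boolp reals.
From mathcomp Require Import mpoly ring.

Set Implicit Arguments.
Unset Strict Implicit.
Unset Printing Implicit Defensive.

Import GRing.Theory.
Local Open Scope quotient_scope.
Local Open Scope ring_scope.

Definition expgz (G : groupType) (g : G) (z : int) : G :=
  match z with Posz m => (g ^+ m)%g | Negz m => (g ^- m.+1)%g end.

Definition length_function (R : realType) (G : groupType) (l : G -> R) : Prop :=
  [/\ forall g, 0 <= l g,
      forall g (z : int), l (expgz g z) = `|z|%:~R * l g,
      forall g h, l (h * g * h^-1)%g = l g
    & forall a b, commute a b -> l (a * b)%g <= l a + l b].

(* A rational map P^n --> P^n is given by n+1 forms of the same degree in n+1
   variables, not all zero, up to the relation [proportional]. *)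
Section RationalMaps.
Variables (k : fieldType) (n : nat).
Implicit Types f g h : n.+1.-tuple {mpoly k[n.+1]}.
Implicit Types p : {mpoly k[n.+1]}.

Definition is_ratmap f : Prop :=
  (exists d, forall i, tnth f i \is d.-homog) /\ (exists i, tnth f i != 0).

Definition proportional f g : bool :=
  [forall i, forall j, tnth f i * tnth g j == tnth f j * tnth g i].

Definition id_forms : n.+1.-tuple {mpoly k[n.+1]} := [tuple 'X_i | i < n.+1].

(* [comp_forms f g] is f after g; all its entries vanish exactly when the
   composite rational map is undefined. *)
Definition comp_forms f g : n.+1.-tuple {mpoly k[n.+1]} :=
  [tuple tnth f i \mPo g | i < n.+1].

Definition lin_forms (A : 'M[k]_n.+1) : n.+1.-tuple {mpoly k[n.+1]} :=
  [tuple \sum_j A i j *: 'X_j | i < n.+1].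

Definition inverse_ratmaps f g : Prop :=
  [/\ is_ratmap (comp_forms f g), proportional (comp_forms f g) id_forms,
      is_ratmap (comp_forms g f) & proportional (comp_forms g f) id_forms].

Definition birational f : Prop :=
  is_ratmap f /\ exists2 g, is_ratmap g & inverse_ratmaps f g.

Lemma proportionalP f g :
  reflect (forall i j, tnth f i * tnth g j = tnth f j * tnth g i)
          (proportional f g).
Proof.
apply: (iffP forallP) => [H i j|H i].
  by have /forallP/(_ j)/eqP := H i.
by apply/forallP => j; apply/eqP.
Qed.

Lemma proportional_refl f : proportional f f.
Proof. by apply/proportionalP => i j; rewrite mulrC. Qed.

Lemma proportional_sym f g : proportional f g = proportional g f.
Proof.
suff H f1 g1 : proportional f1 g1 -> proportional g1 f1.
  by apply/idP/idP; apply: H.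
move=> /proportionalP H; apply/proportionalP => i j.
by rewrite mulrC (H j i) mulrC.
Qed.

Lemma proportional_trans g f h :
  is_ratmap g -> proportional f g -> proportional g h -> proportional f h.
Proof.
have aux (R : comNzRingType) (fi fj fm gi gj gm hi hj : R) :
    fi * gm = fm * gi -> fj * gm = fm * gj -> gi * hj = gj * hi ->
    gm * (fi * hj) = gm * (fj * hi).
  move=> e1 e2 e3; rewrite mulrA [gm * fi]mulrC e1 -mulrA e3 mulrA -e2; ring.
move=> [_ [m gm]] /proportionalP fg /proportionalP gh.
apply/proportionalP => i j; apply: (mulfI gm).
exact: (aux _ _ _ _ _ _ _ _ _ (fg i m) (fg j m) (gh i j)).
Qed.

Lemma proportional_scale f g : is_ratmap f -> is_ratmap g -> proportional f g ->
  exists c c', [/\ c != 0, c' != 0 & forall i, c * tnth f i = c' * tnth g i].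
Proof.
move=> [_ [m fm]] [_ [m' gm']] /proportionalP fg.
exists (tnth g m), (tnth f m); split=> // [|i].
  apply/eqP => gm; have := fg m m'; rewrite gm mulr0 => /eqP.
  by rewrite mulf_eq0 (negbTE fm) (negbTE gm').
by rewrite mulrC fg.
Qed.

Lemma comp_mpoly_scale c f d p : p \is d.-homog ->
  p \mPo [tuple c * tnth f i | i < n.+1] = c ^+ d * (p \mPo f).
Proof.
move=> /dhomogP hp; rewrite !comp_mpolyE mulr_sumr.
rewrite big_seq [RHS]big_seq; apply: eq_bigr => m /hp dm.
rewrite -scalerAr; congr (_ *: _); rewrite -dm /= mdegE.
under eq_bigr => i _ do rewrite tnth_mktuple exprMn.
by rewrite big_split /= expr_sum.
Qed.

Lemma comp_mpoly_scale_eq c c' f g d p : p \is d.-homog ->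
  (forall i, c * tnth f i = c' * tnth g i) ->
  c ^+ d * (p \mPo f) = c' ^+ d * (p \mPo g).
Proof.
move=> hp e; rewrite -!comp_mpoly_scale //; congr (_ \mPo _).
by apply/eq_from_tnth => i; rewrite !tnth_mktuple.
Qed.

Lemma comp_mpolyA p f g : (p \mPo f) \mPo g = p \mPo comp_forms f g.
Proof.
rewrite (comp_mpolyE p f) (comp_mpolyE p (comp_forms f g)) raddf_sum /=.
apply: eq_bigr => m _; rewrite comp_mpolyZ; congr (_ *: _).
rewrite rmorph_prod; apply: eq_bigr => i _.
by rewrite rmorphXn tnth_mktuple.
Qed.

Lemma comp_formsA f g h :
  comp_forms f (comp_forms g h) = comp_forms (comp_forms f g) h.
Proof. by apply/eq_from_tnth => i; rewrite !tnth_mktuple comp_mpolyA. Qed.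

Lemma comp_forms1 f : comp_forms f id_forms = f.
Proof. by apply/eq_from_tnth => i; rewrite !tnth_mktuple comp_mpoly_id. Qed.

Lemma comp_1forms f : comp_forms id_forms f = f.
Proof.
by apply/eq_from_tnth => i; rewrite !tnth_mktuple comp_mpolyXU -tnth_nth.
Qed.

Lemma comp_mpoly_homog p f d e : p \is d.-homog ->
  (forall i, tnth f i \is e.-homog) -> p \mPo f \is (e * d).-homog.
Proof.
move=> /dhomogP hp hf; rewrite comp_mpolyE big_seq.
apply: rpred_sum => m /hp dm; apply: rpredZ.
rewrite -dm /= mdegE big_distrr /=.
elim/big_rec2: _ => [|i q a _ hq]; first exact: dhomog1.
by apply: dhomogM => //; apply: dhomogMn.
Qed.

Lemma proportional_comp f f' g g' :
  is_ratmap f -> is_ratmap g -> is_ratmap g' ->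
  proportional f f' -> proportional g g' ->
  proportional (comp_forms f g) (comp_forms f' g').
Proof.
move=> [[d hd] _] rg rg' /proportionalP ff' gg'.
have [c [c' [c0 c'0 e]]] := proportional_scale rg rg' gg'.
apply/proportionalP => i j; rewrite !tnth_mktuple.
apply: (mulfI (expf_neq0 d c0)); rewrite !mulrA.
rewrite !(comp_mpoly_scale_eq (hd _) e) -!mulrA -!rmorphM /=.
by congr (_ * (_ \mPo _)).
Qed.

Lemma ratmap_id : is_ratmap id_forms.
Proof.
split; last by exists ord0; rewrite tnth_mktuple -msupp_eq0 msuppX.
by exists 1%N => i; rewrite tnth_mktuple dhomogX /= mdeg1.
Qed.

Lemma birational_dominant f d p :
  birational f -> p \is d.-homog -> p != 0 -> p \mPo f != 0.
Proof.
move=> [_ [g _ [rfg pfg _ _]]] hp p0; apply/eqP => pf0.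
have [c [c' [c0 c'0 e]]] := proportional_scale rfg ratmap_id pfg.
have := comp_mpoly_scale_eq hp e.
rewrite -comp_mpolyA pf0 comp_mpoly0 mulr0 comp_mpoly_id => /esym/eqP.
by rewrite mulf_eq0 (negbTE p0) (negbTE (expf_neq0 d c'0)).
Qed.

Lemma ratmap_comp f g : is_ratmap f -> birational g ->
  is_ratmap (comp_forms f g).
Proof.
move=> [[d hd] [i fi]] bg; have [[[e he] _] _] := bg; split.
  by exists (e * d)%N => j; rewrite tnth_mktuple; apply: comp_mpoly_homog.
by exists i; rewrite tnth_mktuple (birational_dominant bg (hd i)).
Qed.

Lemma birational_id : birational id_forms.
Proof.
split; first exact: ratmap_id.
exists id_forms; first exact: ratmap_id.
split; rewrite comp_forms1; [exact: ratmap_id | exact: proportional_refl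
                                 | exact: ratmap_id | exact: proportional_refl].
Qed.

Lemma inverse_ratmaps_sym f g : inverse_ratmaps f g -> inverse_ratmaps g f.
Proof. by case. Qed.

Lemma birational_inv f g :
  is_ratmap f -> is_ratmap g -> inverse_ratmaps f g -> birational g.
Proof.
move=> rf rg H; split; first exact: rg.
exists f; [exact: rf | exact: inverse_ratmaps_sym].
Qed.

Lemma birational_comp f g :
  birational f -> birational g -> birational (comp_forms f g).
Proof.
move=> bf bg; have [rf [f' rf' iff']] := bf; have [rg [g' rg' igg']] := bg.
have bf' := birational_inv rf rf' iff'; have bg' := birational_inv rg rg' igg'.
have half f1 f1' g1 g1' : birational f1 -> birational f1' -> birational g1 ->
    birational g1' -> inverse_ratmaps f1 f1' -> inverse_ratmaps g1 g1' ->
    is_ratmap (comp_forms (comp_forms f1 g1) (comp_forms g1' f1')) /\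
    proportional (comp_forms (comp_forms f1 g1) (comp_forms g1' f1')) id_forms.
  move=> b1 b1' b2 b2' [r1 p1 _ _] [r2 p2 _ _].
  have [q1 _] := b1; have [q1' _] := b1'.
  have e : comp_forms (comp_forms f1 g1) (comp_forms g1' f1') =
           comp_forms f1 (comp_forms (comp_forms g1 g1') f1').
    by rewrite !comp_formsA.
  rewrite e; have r3 := ratmap_comp r2 b1'.
  split.
    rewrite -e; have r4 := ratmap_comp q1 b2.
    rewrite comp_formsA; apply: (ratmap_comp _ b1').
    exact: (ratmap_comp r4 b2').
  apply: (proportional_trans r1 _ p1).
  apply: (proportional_comp q1 r3 q1' (proportional_refl _)).
  rewrite -[X in proportional _ X]comp_1forms.
  exact: (proportional_comp r2 q1' q1' p2 (proportional_refl _)).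
split; first exact: (ratmap_comp rf bg).
exists (comp_forms g' f'); first exact: (ratmap_comp rg' bf').
have [? ?] := half _ _ _ _ bf bf' bg bg' iff' igg'.
have [? ?] := half _ _ _ _ bg' bg bf' bf (inverse_ratmaps_sym igg')
  (inverse_ratmaps_sym iff').
split; assumption.
Qed.

(* Homogeneous representatives of birational self-maps of P^n. *)
Record birep := Birep {
  birep_forms :> n.+1.-tuple {mpoly k[n.+1]};
  birep_subproof : `[< birational birep_forms >] }.

HB.instance Definition _ := [isSub for birep_forms].
HB.instance Definition _ := [Choice of birep by <:].

Lemma birepP (f : birep) : birational f.
Proof. exact/asboolP/birep_subproof. Qed.

Lemma birep_ratmap (f : birep) : is_ratmap f.
Proof. by case: (birepP f). Qed.

Definition mk_birep f (bf : birational f) : birep := Birep (asboolT bf).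

Definition birep_equiv (f g : birep) : bool := proportional f g.

Lemma birep_equiv_refl : reflexive birep_equiv.
Proof. by move=> f; apply: proportional_refl. Qed.

Lemma birep_equiv_sym : ssrbool.symmetric birep_equiv.
Proof. by move=> f g; apply: proportional_sym. Qed.

Lemma birep_equiv_trans : transitive birep_equiv.
Proof. by move=> g f h; apply: proportional_trans; apply: birep_ratmap. Qed.

Canonical birep_equiv_rel := EquivRel birep_equiv birep_equiv_refl
  birep_equiv_sym birep_equiv_trans.

Definition Bir := {eq_quot birep_equiv}.
HB.instance Definition _ := Choice.on Bir.
HB.instance Definition _ := EqQuotient.on Bir.

Definition Bir_one : Bir := \pi_Bir (mk_birep birational_id).

Definition Bir_mul (phi psi : Bir) : Bir :=
  \pi_Bir (mk_birep (birational_comp (birepP (repr phi)) (birepP (repr psi)))).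

Lemma birep_inv_ex (f : birep) :
  exists g : birep, inverse_ratmaps f g.
Proof.
have [rf [g rg ifg]] := birepP f.
by exists (mk_birep (birational_inv rf rg ifg)).
Qed.

Definition Bir_inv (phi : Bir) : Bir :=
  \pi_Bir (projT1 (cid (birep_inv_ex (repr phi)))).

Lemma Bir_eqP (f g : birep) :
  (\pi_Bir f = \pi_Bir g) <-> proportional f g.
Proof. by split=> [/eqmodP|H]; last apply/eqmodP. Qed.

Lemma repr_pi (f : birep) : proportional (repr (\pi_Bir f)) f.
Proof. by apply/Bir_eqP; rewrite reprK. Qed.

Lemma Bir_mulE (f g h : birep) : comp_forms f g = h ->
  Bir_mul (\pi_Bir f) (\pi_Bir g) = \pi_Bir h.
Proof.
move=> e; apply/Bir_eqP; rewrite -e.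
exact: (proportional_comp (birep_ratmap _) (birep_ratmap _) (birep_ratmap _)
  (repr_pi f) (repr_pi g)).
Qed.

Lemma Bir_mul_pi (f g : birep) : Bir_mul (\pi_Bir f) (\pi_Bir g) =
  \pi_Bir (mk_birep (birational_comp (birepP f) (birepP g))).
Proof. by apply: Bir_mulE. Qed.

Lemma Bir_mulA : associative Bir_mul.
Proof.
have H (f g h : birep) :
    Bir_mul (\pi_Bir f) (Bir_mul (\pi_Bir g) (\pi_Bir h)) =
    Bir_mul (Bir_mul (\pi_Bir f) (\pi_Bir g)) (\pi_Bir h).
  rewrite 4!Bir_mul_pi; apply/Bir_eqP; rewrite /mk_birep /=.
  by rewrite (comp_formsA f g h); apply: proportional_refl.
by move=> x y z; have := H (repr x) (repr y) (repr z); rewrite !reprK.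
Qed.

Lemma Bir_mul1g : left_id Bir_one Bir_mul.
Proof.
move=> x; rewrite -[x]reprK; apply: Bir_mulE; exact: comp_1forms.
Qed.

Lemma Bir_mulg1 : right_id Bir_one Bir_mul.
Proof.
move=> x; rewrite -[x]reprK; apply: Bir_mulE; exact: comp_forms1.
Qed.

Lemma Bir_mulVg : left_inverse Bir_one Bir_inv Bir_mul.
Proof.
move=> x; rewrite /Bir_inv -[X in Bir_mul _ X]reprK.
case: cid => g [_ _ r p] /=; rewrite Bir_mul_pi; apply/Bir_eqP; exact: p.
Qed.

Lemma Bir_mulgV : right_inverse Bir_one Bir_inv Bir_mul.
Proof.
move=> x; rewrite /Bir_inv -[X in Bir_mul X _]reprK.
case: cid => g [r p _ _] /=; rewrite Bir_mul_pi; apply/Bir_eqP; exact: p.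
Qed.

HB.instance Definition _ := isGroup.Build Bir
  Bir_mulA Bir_mul1g Bir_mulg1 Bir_mulVg Bir_mulgV.

Definition represents f (phi : Bir) : Prop :=
  exists2 b : birep, birep_forms b = f & \pi_Bir b = phi.

(* [x] stands for the point of P^n with homogeneous coordinates x != 0; another
   choice of coordinates of the same point gives the same proposition. *)
Definition regular_at (phi : Bir) (x : 'rV[k]_n.+1) : Prop :=
  exists2 f, represents f phi & exists i, (tnth f i).@[x 0] != 0.

Definition biregular (phi : Bir) : Prop :=
  forall x, x != 0 -> regular_at phi x /\ regular_at phi^-1%g x.

Definition projective_linear (phi : Bir) : Prop :=
  exists2 A, A \in unitmx & represents (lin_forms A) phi.

End RationalMaps.

(* Main.v *)
From HB Require Import structures.
Require Import Defs.
From mathcomp Require Import all_boot all_order all_algebra.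
From mathcomp Require Import boolp reals.
From mathcomp Require Import mpoly ring lra zify.

(** Regular in both directions implies linear.  The polynomial ring in the
    homogeneous coordinates has unique factorization, so a class of
    proportional tuples of forms contains a tuple [f] without a common prime
    factor, and every other tuple of the class is a multiple of it
    ([reduced_forms_exist], [proportional_multiple]).  Hence a map regular
    everywhere has a reduced tuple with no common zero except the origin.  Let
    [g] be the reduced tuple of the inverse map.  Then [f] after [g] equals
    [h] times the identity for some form [h].  A form of positive degree in at
    least two variables over an algebraically closed field has a nontrivial
    zero [x] ([homog_nontrivial_zero]), and then [g x] would be a nonzero
    common zero of [f].  So [h] is constant, the degrees of [f] and [g] are
    both 1, and [f] is given by an invertible matrix.  Factors of forms are
    forms ([homog_factor]), which is why [f], [g] and [h] are homogeneous.

    Vanishing of the length.  Restricted to invertible matrices, a length is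
    conjugation invariant, satisfies [l (A ^ m) = m * l A] and is subadditive
    on commuting pairs.

    Diagonal matrices: write [D i a] for the matrix scaling the [i]-th
    coordinate by [a].  As there are at least three homogeneous coordinates,
    the monomial map multiplying an affine coordinate by the cube of another
    one conjugates [D i a] to [D i a * D j a ^ 3] ([cremona_diag]).  Dividing by
    [D i a] gives [3 * l (D j a) <= 2 * l (D i a)]; exchanging [i] and [j],
    both lengths vanish.  This is the only point where nonlinear elements of
    the Cremona group are used.

    Unipotent matrices: if 2 = 0 in the field, a power of [1 + N] is 1.
    Otherwise a nilpotent [N] splits off a Jordan block ([jordan_block_split]),
    and a unipotent Jordan block is conjugate to its own square
    ([jordan_block_sqr_conj]), so its length is twice itself; induction on the
    rank of [N] finishes ([mxlength_unipotent]).

    General matrices: [A = S * (1 + S^-1 N)] with commuting factors, [S]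
    diagonalizable and [N] nilpotent ([jordan_chevalley]). *)

Set Implicit Arguments.
Unset Strict Implicit.
Unset Printing Implicit Defensive.

Import GRing.Theory.
Local Open Scope quotient_scope.
Local Open Scope ring_scope.

(** * Unique factorization in polynomial rings *)

Section Factorial.
Variable R : idomainType.
Implicit Types (a b c p q : R) (s : seq R).

Definition divides a b := exists c, b = c * a.

Definition prime_elt p :=
  [/\ p != 0, p \isn't a GRing.unit
    & forall a b, divides p (a * b) -> divides p a \/ divides p b].

Definition product_of_primes a :=
  exists u s, [/\ u \is a GRing.unit, {in s, forall p, prime_elt p}
                & a = u * \prod_(p <- s) p].

Definition factorial_domain := forall a, a != 0 -> product_of_primes a.

Lemma divides_mull p a b : divides p a -> divides p (b * a).
Proof. by case=> c ->; exists (b * c); rewrite mulrA. Qed.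

Lemma divides_add p a b : divides p a -> divides p b -> divides p (a + b).
Proof. by case=> c -> [d ->]; exists (c + d); rewrite mulrDl. Qed.

(** Cancelling a prime from a product of primes shortens the product: the
    prime divides, hence is associated to, one of the factors.  The number of
    factors is thus a measure for inductions on divisibility. *)
Lemma prime_cancel_factor p l u s :
    prime_elt p -> u \is a GRing.unit -> {in s, forall q, prime_elt q} ->
    u * \prod_(q <- s) q = l * p ->
  exists u' s', [/\ u' \is a GRing.unit, {in s', forall q, prime_elt q},
                    (size s' < size s)%N & l = u' * \prod_(q <- s') q].
Proof.
move=> pp uu; have [p0 pu pP] := pp.
elim: s l => [|q s IHs] l sP.
  rewrite big_nil mulr1 => e; case/negP: pu.
  by move: uu; rewrite e unitrM => /andP[].
rewrite big_cons => e.
have [q0 qu qP] : prime_elt q by apply: sP; rewrite inE eqxx.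
have {}sP : {in s, forall q, prime_elt q}.
  by move=> r rs; apply: sP; rewrite inE rs orbT.
have /pP[[t qtp]|[l' e']] : divides p (q * (u * \prod_(q <- s) q)).
- by exists l; rewrite -e mulrCA.
- have tu : t \is a GRing.unit.
    have /qP[[w tw]|[w pw]] : divides q (t * p) by exists 1; rewrite mul1r.
      case/negP: pu; apply/unitrPr; exists w; apply: (mulIf q0).
      by rewrite mul1r {2}qtp tw; ring.
    apply/unitrPr; exists w; apply: (mulIf q0).
    by rewrite mul1r {2}qtp pw; ring.
  exists (u * t), s; split=> //; first by rewrite unitrM uu.
  by apply: (mulIf p0); rewrite -e qtp; ring.
- have [u' [s' [u'u s'P ss' l'E]]] := IHs l' sP e'.
  exists u', (q :: s'); split=> //.
    by move=> r; rewrite inE => /predU1P[->|/s'P].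
  by rewrite big_cons; apply: (mulIf p0); rewrite -e mulrCA e' l'E; ring.
Qed.

(** In [w * a = p * b'] a prime [p] that does not divide [a] divides [w] and
    cancels. *)
Lemma divides_cancel_primes a b s :
    {in s, forall p, prime_elt p} -> {in s, forall p, ~ divides p a} ->
  divides a (\prod_(p <- s) p * b) -> divides a b.
Proof.
elim: s b => [|p s IHs] b sP sa; first by rewrite big_nil mul1r.
rewrite big_cons => -[w e].
have pin : p \in p :: s by rewrite inE eqxx.
have [p0 _ pP] := sP _ pin.
have /pP[[w' ew]|/(sa _ pin)//] : divides p (w * a).
  by rewrite -e; exists (\prod_(q <- s) q * b); ring.
apply: IHs => [q qs|q qs|]; try by [apply: sP; rewrite inE qs orbT
  | apply: sa; rewrite inE qs orbT].
by exists w'; apply: (mulfI p0); rewrite mulrA e ew; ring.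
Qed.

(** Coprimality of a whole family.  The index type is arbitrary so that the
    notion serves for the coefficients of a polynomial and for the
    coordinates of a rational map alike. *)
Definition no_common_prime (I : Type) (f : I -> R) :=
  forall p, prime_elt p -> ~ forall i, divides p (f i).

(** Divide out common primes as long as there are any; the factorization of
    one nonzero member of the family bounds the number of steps. *)
Lemma extract_common_factor (I : Type) (f : I -> R) (i0 : I) :
  factorial_domain -> f i0 != 0 ->
  exists c g, [/\ c != 0, forall i, f i = c * g i & no_common_prime g].
Proof.
move=> UR fi0; have [u [s [uu sP fE]]] := UR _ fi0.
have [n] := ubnP (size s); elim: n => // n IHn in f fi0 u s uu sP fE *.
rewrite ltnS => sn.
have [nf|] := EM (no_common_prime f).
  by exists 1, f; split=> // [|i]; rewrite ?oner_neq0 ?mul1r.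
move=> /existsNP[p /not_implyP[pp /contrapT]] /choice[g fg].
have [p0 _ _] := pp.
have [||u' [s' [uu' sP' ss' gE]]] := @prime_cancel_factor p (g i0) u s pp uu.
- exact: sP.
- by rewrite -fE fg.
have gi0 : g i0 != 0 by apply: contraNneq fi0 => e; rewrite fg e mul0r.
have [|c [h [c0 gh nh]]] := IHn g gi0 u' s' uu' sP' gE.
  exact: leq_trans sn.
exists (c * p), h; split=> // [|i]; first by rewrite mulf_neq0.
by rewrite fg gh; ring.
Qed.

(** The ratio of [g] to [f] has a denominator [f i0].  A prime of this
    denominator misses some [f i], so it divides the numerator and cancels. *)
Lemma proportional_multiple (I : Type) (f g : I -> R) (i0 : I) :
    factorial_domain -> no_common_prime f -> f i0 != 0 ->
    (forall i j, g i * f j = g j * f i) ->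
  exists h, forall i, g i = h * f i.
Proof.
move=> UR nf fi0 gf; have [u [s [uu sP fE]]] := UR _ fi0.
have : forall i, \prod_(p <- s) p * g i = (u^-1 * g i0) * f i.
  move=> i; apply: (mulrI uu); rewrite !mulrA divrr // mul1r -fE.
  by rewrite mulrC gf.
move: (_ * g i0) => a {fE gf}; elim: s a sP => [|p s IHs] a sP.
  by move=> e; exists a => i; rewrite -e big_nil mul1r.
have pp : prime_elt p by apply: sP; rewrite inE eqxx.
have [p0 _ pP] := pp => e.
have {}e i : p * \prod_(q <- s) q * g i = a * f i by rewrite -e big_cons.
have [b ab] : divides p a.
  have [i nfi] : exists i, ~ divides p (f i) by apply/existsNP/nf.
  have /pP[//|//] : divides p (a * f i).
  by rewrite -e; exists (\prod_(q <- s) q * g i); ring.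
apply: (IHs b) => [q qs|i]; first by apply: sP; rewrite inE qs orbT.
apply: (mulfI p0); rewrite mulrA e ab; ring.
Qed.

End Factorial.

Section PolyFactorial.
Import Pdiv.Idomain.
Variable R : idomainType.
Hypothesis UR : factorial_domain R.
Implicit Types (p c : R) (A B C D : {poly R}).

Lemma divides_polyC p A : divides p%:P A <-> forall i, divides p A`_i.
Proof.
split=> [[B ->] i|]; first by exists B`_i; rewrite coefMC.
move=> /choice[f fE]; exists (\poly_(i < size A) f i).
apply/polyP => i; rewrite coefMC coef_poly; case: ltnP => // iA.
by rewrite mul0r nth_default.
Qed.

Lemma divides_polyC_lead p A :
  divides p (lead_coef A) -> divides p%:P (A - lead_coef A *: 'X^((size A).-1)) ->
  divides p%:P A.
Proof.
move=> [c cE] d; rewrite -[A](subrK (lead_coef A *: 'X^((size A).-1))).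
apply: divides_add => //; exists (c *: 'X^((size A).-1)).
by rewrite cE -!mul_polyC polyCM; ring.
Qed.

Lemma size_sub_lead A : A != 0 ->
  (size (A - lead_coef A *: 'X^((size A).-1))%R < size A)%N.
Proof.
move=> A0; rewrite [ltnRHS]polySpred // ltnS; apply/leq_sizeP => j jA.
rewrite coefB coefZ coefXn lead_coefE; case: eqP => [->|/eqP ne].
  by rewrite mulr1 subrr.
rewrite mulr0 subr0 nth_default // (polySpred A0) ltn_neqAle eq_sym ne.
exact: jA.
Qed.

(** Gauss's lemma, by induction on sizes: the prime divides the product of
    the leading coefficients, hence one of them, and that leading term can be
    dropped. *)
Lemma prime_polyC p : prime_elt p -> prime_elt p%:P.
Proof.
move=> [p0 pu pP]; split; first by rewrite polyC_eq0.
  by apply: contra pu; rewrite poly_unitE coefC eqxx => /andP[].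
move=> A B; have [n] := ubnP (size A + size B).
elim: n A B => // n IHn A B; rewrite ltnS => sz.
have [->|A0] := eqVneq A 0; first by left; exists 0; rewrite mul0r.
have [->|B0] := eqVneq B 0; first by right; exists 0; rewrite mul0r.
move=> pAB; have /pP[pa|pb] : divides p (lead_coef A * lead_coef B).
  by rewrite -lead_coefM lead_coefE; have /divides_polyC := pAB; apply.
- have [|||] := IHn (A - lead_coef A *: 'X^((size A).-1)) B.
  + by apply: leq_trans sz; rewrite ltn_add2r size_sub_lead.
  + rewrite mulrBl; apply: divides_add => //.
    rewrite -mul_polyC; case: pa => c ->.
    by exists (- (c%:P * ('X^((size A).-1) * B))); rewrite polyCM; ring.
  + by left; apply: divides_polyC_lead.
  + by right.
- have [|||] := IHn A (B - lead_coef B *: 'X^((size B).-1)).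
  + by apply: leq_trans sz; rewrite ltn_add2l size_sub_lead.
  + rewrite mulrBr; apply: divides_add => //.
    rewrite -mul_polyC; case: pb => c ->.
    by exists (- (c%:P * (A * 'X^((size B).-1)))); rewrite polyCM; ring.
  + by left.
  + by right; apply: divides_polyC_lead.
Qed.

Definition primitive A := forall p, prime_elt p -> ~ divides p%:P A.

(** [A %| B] is divisibility over the fraction field, so it gives [A]
    dividing a constant multiple of [B]; the primes of the constant cancel
    because [A] is primitive. *)
Lemma primitive_divides A B : primitive A -> A %| B -> divides A B.
Proof.
move=> pA /dvdpP[[c Q] /= c0 e]; have [u [s [uu sP cE]]] := UR c0.
apply: (@divides_cancel_primes _ _ _ [seq p%:P | p <- s]).
- by move=> _ /mapP[p ps ->]; apply/prime_polyC/sP.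
- by move=> _ /mapP[p ps ->]; apply/pA/sP.
exists (u^-1%:P * Q); rewrite -mulrA -e cE big_map -rmorph_prod /=.
by rewrite -mul_polyC mulrA -polyCM mulrA mulVr ?mul1r.
Qed.

(** Conversely, a divisor over the fraction field can be corrected by
    constants to a true factor of the same degree. *)
Lemma dvdp_split A D : A != 0 -> D %| A ->
  exists B C, [/\ A = B * C, size C = size D & (size B = 1%N -> A %| D)].
Proof.
move=> A0 /dvdpP[[c Q] /= c0 e]; have [u [s [uu sP cE]]] := UR c0.
have : exists D' Q', [/\ D %= D', size D' = size D
    & \prod_(p <- s) p *: A = Q' * D'].
  exists D, (u^-1%:P * Q); split; rewrite ?eqpxx //.
  by rewrite -mulrA -e cE -!mul_polyC mulrA -polyCM mulrA mulVr ?mul1r.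
elim: s sP {cE} => [|p s IHs] sP [D' [Q' [DD' sD]]].
  rewrite big_nil scale1r => AE; exists Q', D'; split=> // /eqP/size_poly1P.
  move=> [q q0 qE]; rewrite (eqp_dvdr _ DD'); apply/dvdpP.
  by exists (q, 1) => //=; rewrite mul1r AE qE mul_polyC.
rewrite big_cons -scalerA => e'.
have pp : prime_elt p by apply: sP; rewrite inE eqxx.
have [p0 _ _] := pp; have [_ _ pP] := prime_polyC pp.
apply: IHs => [q qs|]; first by apply: sP; rewrite inE qs orbT.
have pI : injective (fun B => p *: B).
  by move=> B B'; rewrite -!mul_polyC; apply: mulfI; rewrite polyC_eq0.
have /pP[[W WE]|[W WE]] : divides p%:P (Q' * D').
- by rewrite -e'; eexists; rewrite mulrC mul_polyC.
- exists D', W; split=> //; apply: pI.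
  by rewrite e' WE mulrC -mul_polyC; ring.
- have sW : p *: W = D' by rewrite WE mulrC mul_polyC.
  exists W, Q'; split.
  + by rewrite (eqp_trans DD') // -sW eqp_scale.
  + by rewrite -sD -sW size_scale.
  + by apply: pI; rewrite e' WE -mul_polyC; ring.
Qed.

(** Euclid's argument over the fraction field: the gcd of [A] and [F] is, up
    to constants, a factor of [A], hence constant or associated to [A]; in the
    first case [A] divides [G]. *)
Lemma irreducible_prime A :
    primitive A -> (1 < size A)%N ->
    (forall B C, A = B * C -> size B = 1%N \/ size C = 1%N) -> prime_elt A.
Proof.
move=> pA sA irrA; have A0 : A != 0 by rewrite -size_poly_gt0 ltnW.
split=> // [|F G].
  by rewrite poly_unitE (gtn_eqF sA).
move=> [W WE]; have AFG : A %| F * G by rewrite WE dvdp_mull.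
have [B [C [AE sC sB]]] := dvdp_split A0 (dvdp_gcdl A F).
have [/sB AD|s1] := irrA _ _ AE.
  by left; apply: primitive_divides => //; apply: dvdp_trans AD (dvdp_gcdr _ _).
right; apply: primitive_divides => //.
have cAF : coprimep A F by rewrite /coprimep -sC s1.
by rewrite -(Gauss_dvdpr G cAF).
Qed.

(** By induction on the degree: a primitive polynomial is a constant (then a
    unit), irreducible (then prime), or a product of two primitive polynomials
    of smaller degree. *)
Lemma factor_primitive A : A != 0 -> primitive A -> product_of_primes A.
Proof.
have [n] := ubnP (size A); elim: n A => // n IHn A; rewrite ltnS => sn A0 pA.
have [A1|A1] := leqP (size A) 1.
  have AE := size1_polyC A1; move: A0; rewrite AE polyC_eq0 => a0.
  have [u [[|p s] [uu sP aE]]] := UR a0; last first.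
    have [] := pA p; first by apply: sP; rewrite inE eqxx.
    exists (u * \prod_(q <- s) q)%:P.
    by rewrite AE aE big_cons -polyCM; congr _%:P; ring.
  exists (A`_0)%:P, [::]; split=> //; last by rewrite big_nil mulr1.
  by rewrite aE big_nil mulr1 rmorph_unit.
have [irrA|] := EM (forall B C, A = B * C -> size B = 1%N \/ size C = 1%N).
  exists 1, [:: A]; split; rewrite ?unitr1 ?big_seq1 ?mul1r //.
  by move=> p /[!inE] /eqP->; apply: irreducible_prime.
move=> /existsNP[B /existsNP[C /not_implyP[AE /not_orP[B1 C1]]]].
have /andP[B0 C0] : (B != 0) && (C != 0) by rewrite -negb_or -mulf_eq0 -AE.
have pB : primitive B.
  by move=> p pp pB; apply: (pA p pp); rewrite AE mulrC; apply: divides_mull.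
have pC : primitive C.
  by move=> p pp pC; apply: (pA p pp); rewrite AE; apply: divides_mull.
have sB : (1 < size B)%N by rewrite ltn_neqAle eq_sym size_poly_gt0 B0 andbT; apply/eqP.
have sC : (1 < size C)%N by rewrite ltn_neqAle eq_sym size_poly_gt0 C0 andbT; apply/eqP.
have sBC : (size A).+1 = (size B + size C)%N.
  by rewrite AE size_mul // prednK // addn_gt0 ltnW.
have [|u [s [uu sP BE]]] := IHn B _ B0 pB.
  by apply: leq_trans sn; rewrite -ltnS sBC; lia.
have [|v [t [vv tP CE]]] := IHn C _ C0 pC.
  by apply: leq_trans sn; rewrite -ltnS sBC; lia.
exists (u * v), (s ++ t); split; first by rewrite unitrM uu.
  by move=> p; rewrite mem_cat => /orP[/sP|/tP].
by rewrite big_cat AE BE CE /=; ring.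
Qed.

Lemma factorial_poly : factorial_domain {poly R}.
Proof.
move=> A A0; have lA : A`_(size A).-1 != 0 by rewrite -lead_coefE lead_coef_eq0.
have [c [f [c0 fE nf]]] := extract_common_factor UR lA.
have AE : A = c%:P * \poly_(i < size A) f i.
  apply/polyP => i; rewrite coefCM coef_poly fE; case: ltnP => // iA.
  by rewrite mulr0 -fE nth_default.
set B := \poly_(i < _) _ in AE.
have B0 : B != 0 by move: A0; rewrite AE; apply: contraNneq => ->; rewrite mulr0.
have pB : primitive B.
  move=> p pp /divides_polyC pB; apply: (nf p pp) => i.
  suff <- : B`_i = f i by [].
  by apply: (mulfI c0); rewrite -fE -coefCM -AE.
have [u [s [uu sP cE]]] := UR c0.
have [v [t [vv tP BE]]] := factor_primitive B0 pB.
exists (u%:P * v), ([seq p%:P | p <- s] ++ t); split.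
- by rewrite unitrM vv andbT rmorph_unit.
- by move=> p; rewrite mem_cat => /orP[/mapP[q /sP qp ->]|/tP//]; apply: prime_polyC.
- by rewrite big_cat big_map -rmorph_prod /= AE BE cE polyCM; ring.
Qed.

End PolyFactorial.

(** * Factorization in several variables *)

Section Transport.
Variables (A B : idomainType) (f : {rmorphism A -> B}) (g : {rmorphism B -> A}).
Hypotheses (fK : cancel f g) (gK : cancel g f).

Lemma prime_elt_iso p : prime_elt p -> prime_elt (f p).
Proof.
move=> [p0 pu pP]; split.
- by rewrite -(can_eq gK) fK rmorph0.
- by apply: contra pu => /(rmorph_unit g); rewrite fK.
move=> a b [c e]; have /pP[[d dE]|[d dE]] : divides p (g a * g b).
- by exists (g c); rewrite -rmorphM e rmorphM fK.
- by left; exists (f d); rewrite -rmorphM -dE gK.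
- by right; exists (f d); rewrite -rmorphM -dE gK.
Qed.

Lemma factorial_iso : factorial_domain A -> factorial_domain B.
Proof.
move=> UA b b0; have gb0 : g b != 0 by rewrite -(can_eq fK) gK rmorph0.
have [u [s [uu sP bE]]] := UA _ gb0.
exists (f u), [seq f p | p <- s]; split; first exact: rmorph_unit.
  by move=> _ /mapP[p /sP pp ->]; apply: prime_elt_iso.
by rewrite big_map -rmorph_prod -rmorphM -bE gK.
Qed.

End Transport.

Section LastVariable.
Variables (R : idomainType) (n : nat).

Local Notation widen := (widen_ord (leqnSn n)).

(** Inverse of [muni]: evaluate a univariate polynomial over the ring in the
    first [n] variables at the last variable. *)
Definition of_uni : {rmorphism {poly {mpoly R[n]}} -> {mpoly R[n.+1]}} :=
  horner_eval 'X_ord_max \o map_poly (@mwiden n R).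

Lemma of_uniC c : of_uni c%:P = mwiden c.
Proof. by rewrite /= /horner_eval map_polyC hornerC. Qed.

Lemma of_uniX : of_uni 'X = 'X_ord_max.
Proof. by rewrite /= /horner_eval map_polyX hornerX. Qed.

Lemma muni_monom (m : 'X_{1..n.+1}) :
  muni 'X_[m] = 'X_[R, [multinom m (widen i) | i < n]] *: 'X^(m ord_max).
Proof. by rewrite muniE msuppX big_seq1 mcoeffX eqxx scale1r. Qed.

Lemma muniK : cancel (@muni n R) of_uni.
Proof.
elim/mpolyind => [|c m p _ _ IH]; first by rewrite muni0 (rmorph0 of_uni).
rewrite muniD [LHS](rmorphD of_uni); apply: (congr2 +%R _ IH).
rewrite muniZ muni_monom -!mul_polyC !rmorphM rmorphXn /=.
rewrite /= /horner_eval !map_polyC map_polyX !hornerC hornerX /=.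
rewrite mwidenC mwidenX mul_mpolyC; congr (_ *: _).
rewrite mpolyXn -mpolyXD; congr 'X_[_]; apply/mnmP => i.
rewrite mnmDE mulmnE mnm1E.
have [j ->|->] := unliftP ord_max i; last first.
  by rewrite mnmwiden_ordmax eqxx add0n mul1n.
rewrite (negbTE (neq_lift _ _)) mul0n addn0.
have -> : lift ord_max j = widen j by apply: val_inj; rewrite /= /bump leqNgt ltn_ord.
by rewrite mnmwiden_widen mnmE.
Qed.

Lemma muni_mwiden (c : {mpoly R[n]}) : muni (mwiden c) = c%:P.
Proof.
elim/mpolyind: c => [|c m p _ _ IH]; first by rewrite !rmorph0.
rewrite !rmorphD /= IH; congr (_ + _).
rewrite mwidenZ mwidenX muniZ muni_monom mnmwiden_ordmax expr0 alg_polyC.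
rewrite -mul_polyC -polyCM mul_mpolyC; congr (_ *: 'X_[_])%:P.
by apply/mnmP => i; rewrite mnmE mnmwiden_widen.
Qed.

Lemma of_uniK : cancel of_uni (@muni n R).
Proof.
elim/poly_ind => [|p c IH]; first by rewrite (rmorph0 of_uni) muni0.
rewrite (rmorphD of_uni) (rmorphM of_uni) muniD muniM IH; congr (_ * _ + _).
  rewrite of_uniX muni_monom mnm1E eqxx expr1.
  rewrite (_ : [multinom _ | _ < _] = 0%MM) ?mpolyX0 ?scale1r //.
  apply/mnmP => i; rewrite mnmE mnm1E mnm0E.
  by case: eqP => // /(congr1 val) /= /eqP; rewrite gtn_eqF.
by rewrite of_uniC muni_mwiden.
Qed.

End LastVariable.

Lemma factorial_mpoly (F : fieldType) n : factorial_domain {mpoly F[n]}.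
Proof.
elim: n => [|n IHn]; last first.
  exact: factorial_iso (@of_uniK F n) (@muniK F n) (factorial_poly IHn).
move=> p p0; exists p, [::]; split=> //; last by rewrite big_nil mulr1.
have pE : p = (p@_0)%:MP.
  apply/mpolyP => m; rewrite mcoeffC (_ : m = 0%MM) ?eqxx ?mulr1 //.
  by apply/mnmP; case.
rewrite pE rmorph_unit // unitfE; apply: contraNneq p0 => p00.
by rewrite pE p00 mpolyC0.
Qed.

(** * Homogeneous polynomials *)

(** Remove the root 0 repeatedly from one of the two factors; what remains in
    the end is a pair of constants. *)
Lemma mul_eq_scale_Xn (R : idomainType) (P Q : {poly R}) (c : R) d :
  c != 0 -> P * Q = c *: 'X^d -> exists a e, P = a *: 'X^e.
Proof.
move=> c0; elim: d P Q => [|d IHd] P Q PQ.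
  have : (size (P * Q)%R <= 1)%N by rewrite PQ expr0 alg_polyC size_polyC leq_b1.
  have [->|P0] := eqVneq P 0; first by exists 0, 0%N; rewrite scale0r.
  have [Q0|Q0] := eqVneq Q 0.
    move: PQ; rewrite Q0 mulr0 expr0 alg_polyC => /esym/eqP.
    by rewrite polyC_eq0 (negbTE c0).
  rewrite size_mul // => s; exists P`_0, 0%N; rewrite expr0 alg_polyC.
  apply: size1_polyC; move: s; rewrite (polySpred Q0) addnS /=; lia.
have : root P 0 || root Q 0.
  by rewrite -rootM PQ rootE hornerZ hornerXn expr0n mulr0.
have XI : injective (fun p : {poly R} => p * 'X).
  by move=> p q; apply: mulIf; rewrite polyX_eq0.
move=> /orP[]/factor_theorem[W]; rewrite subr0 => WE.
- have [|a [e aE]] := IHd W Q.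
    by apply: XI; rewrite /= mulrAC -WE PQ exprSr scalerAl.
  by exists a, e.+1; rewrite WE aE exprSr scalerAl.
- by apply: (IHd P W); apply: XI; rewrite /= -mulrA -WE PQ exprSr scalerAl.
Qed.

Section Homogeneous.
Variables (R : idomainType) (n : nat).
Implicit Types p q : {mpoly R[n]}.

(** Substitution of [t * X_i] for [X_i], with a new variable [t] recording the
    degree: [p] is homogeneous exactly when its image is a monomial in [t].
    Being a ring morphism, it turns factorizations of forms into
    factorizations of monomials. *)
Definition graded : {mpoly R[n]} -> {poly {mpoly R[n]}} :=
  mmap (polyC \o @mpolyC n R) (fun i => ('X_i)%:P * 'X).

Lemma gradedE p :
  graded p = \sum_(m <- msupp p) (p@_m *: 'X_[m]) *: 'X^(mdeg m).
Proof.
rewrite /graded /mmap; apply: eq_bigr => m _; rewrite /mmap1.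
under eq_bigr do rewrite exprMn.
rewrite big_split /= -expr_sum -mdegE -mul_mpolyC -mul_polyC polyCM -mulrA.
congr (_ * (_ * _)); rewrite mpolyXE_id rmorph_prod /=.
by apply: eq_bigr => i _; rewrite rmorphXn.
Qed.

Lemma gradedM p q : graded (p * q) = graded p * graded q.
Proof. by rewrite /graded rmorphM. Qed.

Lemma graded_homog d p : p \is d.-homog -> graded p = p *: 'X^d.
Proof.
move=> /dhomogP hp; rewrite gradedE [in RHS](mpolyE p) scaler_suml.
by rewrite big_seq [RHS]big_seq; apply: eq_bigr => m /hp <-.
Qed.

Lemma mcoeff_graded p e m :
  ((graded p)`_e)@_m = if mdeg m == e then p@_m else 0.
Proof.
rewrite gradedE coef_sum raddf_sum /=.
under eq_bigr do rewrite coefZ coefXn mulr_natr mcoeffMn mcoeffZ mcoeffX.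
have [pm|npm] := boolP (m \in msupp p).
  rewrite (bigD1_seq m) ?msupp_uniq //= big1 ?addr0 => [|i /negbTE->].
    by rewrite eqxx eq_sym mulr1; case: eqP.
  by rewrite mulr0 mul0rn.
rewrite big_seq big1 => [|i pi]; first by rewrite (memN_msupp_eq0 npm) if_same.
have -> : (i == m) = false by apply: contraNF npm => /eqP<-.
by rewrite mulr0 mul0rn.
Qed.

Lemma homog_graded p a e : graded p = a *: 'X^e -> p \is e.-homog.
Proof.
move=> gE; apply/dhomogP => m pm; apply/eqP; apply: contraTT pm => ne.
rewrite mcoeff_msupp negbK; have := mcoeff_graded p (mdeg m) m.
by rewrite eqxx gE coefZ coefXn (negbTE ne) mulr0 mcoeff0 => <-.
Qed.

Lemma homog_factor d p q : p * q != 0 -> p * q \is d.-homog ->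
  exists e, p \is e.-homog.
Proof.
move=> pq0 /graded_homog; rewrite gradedM.
move=> /(mul_eq_scale_Xn pq0)[a [e /homog_graded pe]]; by exists e.
Qed.

Lemma homog_divisor d e p q : p != 0 -> p \is e.-homog -> p * q \is d.-homog ->
  q \is (d - e)%N.-homog.
Proof.
move=> p0 pe pqd; have [->|q0] := eqVneq q 0; first exact: dhomog0.
have pq0 : p * q != 0 by rewrite mulf_neq0.
have [c qc] : exists c, q \is c.-homog.
  by apply: (@homog_factor d q p); rewrite mulrC.
by rewrite -(dhomog_uniq pq0 (dhomogM pe qc) pqd) addKn.
Qed.

End Homogeneous.

Lemma coefM_top (R : nzRingType) (P Q : {poly R}) d e :
  (size P <= d.+1)%N -> (size Q <= e.+1)%N ->
  (size (P * Q)%R <= (d + e).+1)%N /\ (P * Q)`_(d + e) = P`_d * Q`_e.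
Proof.
move=> sP sQ; split.
  by apply: leq_trans (size_polyMleq _ _) _; lia.
rewrite coefM (bigD1 (inord d : 'I_(d + e).+1)) //= inordK ?ltnS ?leq_addr //.
rewrite addKn big1 ?addr0 // => i ne.
have [id|di] := ltnP i d.
  by rewrite [X in _ * X]nth_default ?mulr0 // (leq_trans sQ) //; lia.
rewrite nth_default ?mul0r // (leq_trans sP) // ltn_neqAle di andbT.
by apply: contra ne => /eqP e'; apply/eqP/val_inj; rewrite /= inordK ?e' // ltnS leq_addr.
Qed.

(** Restrict [h] to the affine line [t * a + u] for two coordinate vectors [a]
    and [u].  The coefficient of degree [d + 1] of the restriction is [h a]; so
    either [a] is a zero of [h], or the restriction is not constant and has a
    root. *)
Lemma homog_nontrivial_zero (F : closedFieldType) n (h : {mpoly F[n.+1]}) d :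
  (0 < n)%N -> h \is d.+1.-homog -> exists2 x : 'rV[F]_n.+1, x != 0 & h.@[x 0] = 0.
Proof.
move=> n0 /dhomogP hd.
pose u : 'rV[F]_n.+1 := delta_mx 0 ord_max.
pose a : 'rV[F]_n.+1 := delta_mx 0 ord0.
pose L i := a 0 i *: 'X + (u 0 i)%:P : {poly F}.
pose P := \sum_(m <- msupp h) h@_m *: \prod_i L i ^+ m i.
have PE t : P.[t] = h.@[(t *: a + u) 0].
  rewrite /P horner_sum mevalE; apply: eq_bigr => m _.
  rewrite hornerZ horner_prod; congr (_ * _); apply: eq_bigr => i _.
  by rewrite horner_exp hornerD hornerZ hornerX hornerC !mxE [t * _]mulrC.
have sL i : (size (L i) <= 2)%N.
  rewrite (leq_trans (size_polyD _ _)) // geq_max size_polyC.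
  rewrite (leq_trans (size_scale_leq _ _)) ?size_polyX //.
  by rewrite (leq_trans (leq_b1 _)).
have topX i k : (size (L i ^+ k) <= k.+1)%N /\ (L i ^+ k)`_k = a 0 i ^+ k.
  elim: k => [|k [sk ck]]; first by rewrite !expr0 size_poly1 coef1.
  rewrite !exprS; have [sM cM] := coefM_top (sL i) sk; split; first exact: sM.
  by rewrite -[k.+1]add1n cM ck coefD coefZ coefX coefC /= mulr1 addr0.
have top (m : 'X_{1..n.+1}) : (size (\prod_i L i ^+ m i)%R <= (mdeg m).+1)%N /\
             (\prod_i L i ^+ m i)`_(mdeg m) = \prod_i a 0 i ^+ m i.
  rewrite mdegE; elim/big_rec3: _ => [|i c d' Q _ [sQ cQ]].
    by rewrite size_poly1 coef1.
  have [sX cX] := topX i (m i).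
  have [sM cM] := coefM_top sX sQ; split; first exact: sM.
  by rewrite cM cX cQ.
have Pd : P`_d.+1 = h.@[a 0].
  rewrite /P coef_sum mevalE big_seq [RHS]big_seq; apply: eq_bigr => m mh.
  by have [_] := top m; rewrite coefZ (hd m mh) => ->.
have [ha|ha] := eqVneq h.@[a 0] 0.
  exists a => //; apply/eqP => /rowP/(_ ord0); rewrite !mxE !eqxx => /eqP.
  by rewrite oner_eq0.
have /closed_rootP[t] : size P != 1%N.
  rewrite gtn_eqF // ltnNge; apply: contra ha => sP.
  by rewrite -Pd nth_default // (leq_trans sP).
rewrite rootE PE => /eqP ht; exists (t *: a + u) => //.
apply/eqP => /rowP/(_ ord_max); rewrite !mxE !eqxx -val_eqE /=.
rewrite (gtn_eqF n0) mulr0 add0r => /eqP.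
by rewrite oner_eq0.
Qed.

(** * Everywhere biregular maps are linear *)

Section LinearForms.
Variables (k : fieldType) (n : nat).
Implicit Types A B : 'M[k]_n.+1.

Lemma lin_formsM A B : comp_forms (lin_forms A) (lin_forms B) = lin_forms (A *m B).
Proof.
apply/eq_from_tnth => i; rewrite !tnth_mktuple raddf_sum /=.
under eq_bigr => j _ do
  rewrite comp_mpolyZ comp_mpolyXU -tnth_nth tnth_mktuple scaler_sumr.
rewrite exchange_big /=; apply: eq_bigr => l _; rewrite mxE scaler_suml.
by apply: eq_bigr => j _; rewrite scalerA.
Qed.

Lemma scale_lin_forms A c i : c *: tnth (lin_forms A) i = tnth (lin_forms (c *: A)) i.
Proof.
rewrite !tnth_mktuple scaler_sumr; apply: eq_bigr => j _.
by rewrite mxE scalerA.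
Qed.

Lemma lin_forms1 : lin_forms 1%:M = id_forms k n.
Proof.
apply/eq_from_tnth => i; rewrite !tnth_mktuple (bigD1 i) //= mxE eqxx scale1r.
by rewrite big1 ?addr0 // => j; rewrite mxE eq_sym => /negbTE->; rewrite scale0r.
Qed.

Lemma mcoeff_lin_forms A i j : (tnth (lin_forms A) i)@_U_(j) = A i j.
Proof.
rewrite tnth_mktuple raddf_sum /= (bigD1 j) //= mcoeffZ mcoeffX eqxx mulr1.
rewrite big1 ?addr0 // => l lj; rewrite mcoeffZ mcoeffX.
by rewrite eq_mnm1 (negbTE lj) mulr0.
Qed.

Lemma meval_lin_forms A i (x : 'rV[k]_n.+1) :
  (tnth (lin_forms A) i).@[x 0] = (A *m x^T) i 0.
Proof.
rewrite tnth_mktuple raddf_sum mxE /=; apply: eq_bigr => j _.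
by rewrite mevalZ mevalXU mxE.
Qed.

Lemma homog1_lin_forms (f : n.+1.-tuple {mpoly k[n.+1]}) :
  (forall i, tnth f i \is 1.-homog) -> f = lin_forms (\matrix_(i, j) (tnth f i)@_U_(j)).
Proof.
move=> f1; apply/eq_from_tnth => i; apply/mpolyP => m.
have [/mdeg1P[j /eqP->]|m1] := boolP (mdeg m == 1%N).
  by rewrite mcoeff_lin_forms mxE.
rewrite (dhomog_nemf_coeff (f1 i) m1) tnth_mktuple raddf_sum big1 //= => j _.
rewrite mcoeffZ mcoeffX; case: eqP => [e|_]; last by rewrite mulr0.
by rewrite -e mdeg1 in m1.
Qed.

Lemma ratmap_lin A : A \in unitmx -> is_ratmap (lin_forms A).
Proof.
move=> uA; split.
  exists 1%N => i; rewrite tnth_mktuple; apply: rpred_sum => j _.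
  by apply: rpredZ; rewrite dhomogX /= mdeg1.
apply: contrapT => /forallNP A0.
have A00 : A = 0.
  apply/matrixP => i j; rewrite mxE -mcoeff_lin_forms.
  by have /negP := A0 i; rewrite negbK => /eqP->; rewrite mcoeff0.
by move: uA; rewrite A00 unitmxE det0 unitr0.
Qed.

Lemma birational_lin A : A \in unitmx -> birational (lin_forms A).
Proof.
move=> uA; have uA' : invmx A \in unitmx by rewrite unitmx_inv.
split; first exact: ratmap_lin.
exists (lin_forms (invmx A)); first exact: ratmap_lin.
by split; rewrite lin_formsM ?mulmxV ?mulVmx // lin_forms1;
  by [exact: ratmap_id | exact: proportional_refl].
Qed.

End LinearForms.

Section RegularEverywhere.
Variables (k : fieldType) (n : nat).
Implicit Types (phi : Bir k n) (f g : n.+1.-tuple {mpoly k[n.+1]}).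

(** Stated through proportionality to the representatives of [phi], so that a
    tuple can be recognized as reduced before it is known to be birational. *)
Definition reduced_forms phi f := [/\ is_ratmap f, no_common_prime (tnth f)
  & forall b : birep k n, \pi_(Bir k n) b = phi -> proportional b f].

Lemma reduced_forms_exist phi : exists f, reduced_forms phi f.
Proof.
have [[d hd] [i fi0]] := birep_ratmap (repr phi).
have [c [g [c0 fg ng]]] := extract_common_factor (@factorial_mpoly k n.+1) fi0.
pose f := [tuple g i | i < n.+1].
have fE j : tnth (repr phi) j = c * tnth f j by rewrite fg tnth_mktuple.
have [e ce] : exists e, c \is e.-homog.
  apply: (@homog_factor _ _ d _ (tnth f i)); by rewrite -fE.
have rf : is_ratmap f.
  split; first by exists (d - e)%N => j; apply: (homog_divisor c0 ce); rewrite -fE.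
  by exists i; apply: contraNneq fi0 => f0; rewrite fE f0 mulr0.
exists f; split=> // [p pp pf|b bphi].
  by apply: (ng p pp) => j; have := pf j; rewrite tnth_mktuple.
have /Bir_eqP : \pi_(Bir k n) b = \pi_(Bir k n) (repr phi) by rewrite reprK.
move=> /proportional_trans; apply; first exact: birep_ratmap.
by apply/proportionalP => j l; rewrite !fE; ring.
Qed.

(** Any representative is a multiple of the reduced one, so it vanishes
    wherever the reduced one does. *)
Lemma reduced_forms_regular phi f x : reduced_forms phi f -> regular_at phi x ->
  exists i, (tnth f i).@[x 0] != 0.
Proof.
move=> [[_ [i0 fi0]] nf pf] [_ [b <- /pf /proportionalP bf] [i bi]].
have [h hE] := proportional_multiple (@factorial_mpoly k n.+1) nf fi0 bf.
exists i; apply: contraNneq bi => fi.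
by rewrite hE mevalM fi mulr0.
Qed.

(** By degree, a divisor of a variable is either a constant or a constant
    multiple of this variable; the latter does not divide another variable,
    as seen at a point on the hyperplane where the first one vanishes. *)
Lemma no_common_prime_id_forms : (0 < n)%N -> no_common_prime (tnth (id_forms k n)).
Proof.
move=> n0 p [p0 pu _] pX.
have [c0] := pX ord0; have [c1] := pX ord_max; rewrite !tnth_mktuple => X1 X0.
have Xn0 (i : 'I_n.+1) : 'X_i != 0 :> {mpoly k[n.+1]}.
  by rewrite -msize_poly_eq0 msizeX mdeg1.
have c00 : c0 != 0 by apply: contra_neq (Xn0 ord0) => e; rewrite X0 e mul0r.
have : msize ('X_(ord0 : 'I_n.+1) : {mpoly k[n.+1]}) = 2 by rewrite msizeX mdeg1.
rewrite X0 msizeM // => s.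
have [c1P|p1P] : (msize c0 <= 1)%N \/ (msize p <= 1)%N by lia.
  have c0E := msize1_polyC c1P.
  have : (c0@_0)%:MP != 0 :> {mpoly k[n.+1]} by rewrite -c0E.
  rewrite mpolyC_eq0 => c00'.
  have := congr1 (meval (fun i => (i == ord_max)%:R)) X0.
  rewrite mevalXU c0E mevalM mevalC -val_eqE /= eq_sym (gtn_eqF n0) => /esym/eqP.
  rewrite mulf_eq0 (negbTE c00') /= => /eqP pe.
  have := congr1 (meval (fun i => (i == ord_max)%:R)) X1.
  by rewrite mevalXU eqxx mevalM pe mulr0 => /eqP; rewrite oner_eq0.
have pE := msize1_polyC p1P; case/negP: pu; rewrite pE rmorph_unit // unitfE.
by rewrite -(mpolyC_eq0 n.+1) -pE.
Qed.

End RegularEverywhere.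

Section Biregular.
Variables (k : closedFieldType) (n : nat).
Hypothesis n_gt0 : (0 < n)%N.
Implicit Types phi : Bir k n.

Lemma projective_linear_regular A phi x :
  A \in unitmx -> represents (lin_forms A) phi -> x != 0 -> regular_at phi x.
Proof.
move=> uA rA x0; exists (lin_forms A) => //; apply: contrapT => /forallNP Ax.
case/eqP: x0; apply: trmx_inj; rewrite trmx0 -[x^T](mulKmx uA).
rewrite (_ : A *m x^T = 0) ?mulmx0 //; apply/colP => i; rewrite [RHS]mxE.
by have /negP := Ax i; rewrite negbK meval_lin_forms => /eqP.
Qed.

Lemma represents_inv A phi : A \in unitmx -> represents (lin_forms A) phi ->
  represents (lin_forms (invmx A)) phi^-1%g.
Proof.
move=> uA [b bA <-]; have uA' : invmx A \in unitmx by rewrite unitmx_inv.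
exists (mk_birep (birational_lin uA')) => //.
apply: (mulgI (\pi_(Bir k n) b)); rewrite mulgV.
apply: Bir_mulE => /=; by rewrite bA lin_formsM mulmxV // lin_forms1.
Qed.

Lemma projective_linear_biregular phi : projective_linear phi -> biregular phi.
Proof.
move=> [A uA rA] x x0; split; first exact: projective_linear_regular rA x0.
apply: projective_linear_regular (represents_inv uA rA) x0.
by rewrite unitmx_inv.
Qed.

(** The composite of the reduced tuples [f] of [phi] and [g] of its inverse is
    [h] times the identity; the form [h] has no zero besides the origin, hence
    is constant, and comparing degrees makes [f] and [g] linear. *)
Lemma biregular_projective_linear phi : biregular phi -> projective_linear phi.
Proof.
move=> bphi.
have [f [rf nf pf]] := reduced_forms_exist phi.
have [g [rg ng pg]] := reduced_forms_exist phi^-1%g.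
have fx (x : 'rV[k]_n.+1) : x != 0 -> exists i, (tnth f i).@[x 0] != 0.
  by move=> /bphi[/reduced_forms_regular + _]; apply.
have gx (x : 'rV[k]_n.+1) : x != 0 -> exists i, (tnth g i).@[x 0] != 0.
  by move=> /bphi[_ /reduced_forms_regular]; apply.
have fg : proportional (comp_forms f g) (id_forms k n).
  pose b := repr phi; pose c := repr phi^-1%g.
  have bc : proportional (comp_forms b c) (id_forms k n).
    have /Bir_eqP : \pi_(Bir k n) (mk_birep (birational_comp (birepP b) (birepP c)))
      = \pi_(Bir k n) (mk_birep (birational_id k n)).
      by rewrite -Bir_mul_pi !reprK; exact: Bir_mulgV.
    by [].
  apply: proportional_trans bc.
    exact: ratmap_comp (birep_ratmap b) (birepP c).
  apply: proportional_comp rf rg (birep_ratmap c) _ _; rewrite proportional_sym.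
    by apply: pf; rewrite reprK.
  by apply: pg; rewrite reprK.
have [h hE] : exists h, forall i, tnth (comp_forms f g) i = h * 'X_i.
  have [|h hE] := proportional_multiple (@factorial_mpoly k n.+1)
    (@no_common_prime_id_forms k n n_gt0) (i0 := ord0) _ (elimT (proportionalP _ _) fg).
    by rewrite tnth_mktuple -msize_poly_eq0 msizeX mdeg1.
  by exists h => i; rewrite hE tnth_mktuple.
(* At a zero of [h] other than the origin, [f] would vanish at the value of [g],
   which is a nonzero vector. *)
have h_nonvanishing (x : 'rV[k]_n.+1) : x != 0 -> h.@[x 0] != 0.
  move=> x0; pose y : 'rV_n.+1 := \row_j (tnth g j).@[x 0].
  have /fx[i] : y != 0.
    have [i] := gx x x0; apply: contra_neq => /rowP/(_ i).
    by rewrite !mxE.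
  apply: contra_neq => hx; transitivity (tnth (comp_forms f g) i).@[x 0].
    rewrite tnth_mktuple comp_mpoly_meval; apply: meval_eq => j.
    by rewrite mxE.
  by rewrite hE mevalM hx mul0r.
have [[d fd] _] := rf; have [[e ge] _] := rg.
have hX i : h * 'X_i \is (e * d)%N.-homog.
  by rewrite -hE tnth_mktuple; apply: comp_mpoly_homog.
have X1 i : 'X_i \is [in k[n.+1], 1.-homog] by rewrite dhomogX /= mdeg1.
have X0 i : 'X_i != 0 :> {mpoly k[n.+1]} by rewrite -msize_poly_eq0 msizeX mdeg1.
have h0 : h.@[(const_mx 1 : 'rV_n.+1) 0] != 0.
  apply: h_nonvanishing; apply/eqP => /rowP/(_ ord0); rewrite !mxE => /eqP.
  by rewrite oner_eq0.
have {}h0 : h != 0 by apply: contra_neq h0 => ->; rewrite meval0.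
have h_homog : h \is (e * d - 1)%N.-homog.
  by apply: homog_divisor (X0 ord0) (X1 ord0) _; rewrite mulrC.
have ed1 : (e * d - 1 = 0)%N.
  case: (e * d - 1)%N h_homog => // m hm; exfalso.
  by have [x /h_nonvanishing/eqP] := homog_nontrivial_zero n_gt0 hm.
rewrite ed1 in h_homog.
have edE : (0 + 1 = e * d)%N.
  apply: dhomog_uniq (mulf_neq0 h0 (X0 ord0)) (dhomogM h_homog (X1 _)) (hX ord0).
have [d1 e1] : d = 1%N /\ e = 1%N.
  by move: edE => /esym/eqP; rewrite muln_eq1 => /andP[/eqP-> /eqP->].
have [c hc] : exists c, h = c%:MP.
  exists h@_0; apply/mpolyP => m; rewrite mcoeffC eq_sym.
  have [->|m0] := eqVneq m 0%MM; first by rewrite mulr1.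
  by rewrite mulr0 (dhomog_nemf_coeff h_homog) ?mdeg_eq0.
rewrite d1 in fd; rewrite e1 in ge.
move: (homog1_lin_forms fd) (homog1_lin_forms ge).
set A := \matrix_(i, j) _; set B := \matrix_(i, j) _ => fA gB.
have AB : A *m B = c%:M.
  apply/matrixP => i j; rewrite -mcoeff_lin_forms -lin_formsM -fA -gB hE hc.
  by rewrite mcoeffCM mcoeffX eq_mnm1 mxE mulr_natr.
have c0 : c != 0 by apply: contra_neq h0 => c0; rewrite hc c0 mpolyC0.
have [uA _] : A \in unitmx /\ c^-1 *: B \in unitmx.
  by apply: mulmx1_unit; rewrite -scalemxAr AB scale_scalar_mx mulVf.
exists A => //; exists (mk_birep (birational_lin uA)) => //.
rewrite -[phi]reprK; apply/Bir_eqP; rewrite proportional_sym /= -fA.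
by apply: pf; rewrite reprK.
Qed.

End Biregular.

(** * Jordan chains and the Jordan-Chevalley decomposition *)

Section Nilpotent.
Variable (S : unitRingType).
Implicit Types x y : S.

Lemma unit_1sub_nilpotent x m : x ^+ m = 0 -> 1 - x \is a GRing.unit.
Proof.
move=> xm; apply/unitrP; exists (\sum_(i < m) x ^+ i).
have e : (1 - x) * \sum_(i < m) x ^+ i = 1.
  by rewrite -[1 - x]opprB mulNr -subrX1 xm sub0r opprK.
split=> //; rewrite -[RHS]e; apply/commr_sym.
by apply: commr_sum => i _; apply: commrX; apply/commr_sym/commrB; [exact: commr1|].
Qed.

Lemma unit_1add_nilpotent x m : x ^+ m = 0 -> 1 + x \is a GRing.unit.
Proof.
move=> xm; rewrite -[x]opprK; apply: (@unit_1sub_nilpotent _ m).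
by rewrite exprNn xm mulr0.
Qed.

End Nilpotent.

Section Shift.
Variables (k : fieldType) (r : nat).

Definition shift_mx : 'M[k]_r := \matrix_(i, j) (j == i.+1 :> nat)%:R.

(** Row [i] lists the low coefficients of [q i].  In this encoding right
    multiplication by the shift is multiplication by ['X] modulo ['X^r]. *)
Definition coef_mx (q : nat -> {poly k}) : 'M[k]_r := \matrix_(i, j) (q i)`_j.

Lemma coef_mx_shift q : coef_mx q *m shift_mx = coef_mx (fun i => q i * 'X).
Proof.
apply/matrixP => i j; rewrite !mxE coefMX.
have [j0|j0] := posnP j.
  by rewrite big1 // => l _; rewrite !mxE j0 mulr0.
have lj : (j.-1 < r)%N by rewrite (leq_ltn_trans (leq_pred _)).
rewrite (bigD1 (Ordinal lj)) //= !mxE /= prednK // eqxx mulr1 big1 ?addr0 //.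
move=> l; rewrite -val_eqE /= => lne; rewrite !mxE (_ : _ == _ = false) ?mulr0 //.
by apply: contraNF lne => /eqP->.
Qed.

Lemma shift_coef_mx (q : nat -> {poly k}) : (forall j, (j < r)%N -> (q r)`_j = 0) ->
  shift_mx *m coef_mx q = coef_mx (fun i => q i.+1).
Proof.
move=> qr; apply/matrixP => i j; rewrite !mxE.
have [ir|ir] := ltnP i.+1 r.
  rewrite (bigD1 (Ordinal ir)) //= !mxE eqxx mul1r big1 ?addr0 // => l.
  by rewrite -val_eqE /= !mxE => /negbTE->; rewrite mul0r.
have -> : i.+1 = r by apply/eqP; rewrite eqn_leq ltn_ord.
rewrite qr // big1 // => l _; rewrite !mxE (_ : _ == _ = false) ?mul0r //.
by rewrite ltn_eqF // (leq_trans (ltn_ord l)).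
Qed.

(** Write [1 + J] for the block.  Its square is [1 + p J] with
    [p = 2 X + X ^ 2], and the powers of [p] form a basis of the polynomials
    modulo ['X^r], triangular with diagonal entries [2 ^ i].  The base change to
    this basis intertwines the two matrices. *)
Lemma jordan_block_sqr_conj : 2%:R != 0 :> k ->
  exists2 Q : 'M[k]_r, Q \in unitmx
    & (1%:M + shift_mx) *m Q = Q *m ((1%:M + shift_mx) *m (1%:M + shift_mx)).
Proof.
move=> two; pose p : {poly k} := ('X + 2%:R%:P) * 'X.
have pi i : p ^+ i = ('X + 2%:R%:P) ^+ i * 'X^i by rewrite exprMn.
exists (coef_mx (fun i => p ^+ i)).
  rewrite unitmxE -det_tr det_trig.
    rewrite unitfE; apply/prodf_neq0 => i _; rewrite !mxE pi coefMXn ltnn subnn.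
    by rewrite -horner_coef0 horner_exp hornerD hornerX hornerC add0r expf_neq0.
  by apply/is_trig_mxP => i j ij; rewrite !mxE pi coefMXn ij.
have add1 q : coef_mx q *m (1%:M + shift_mx) = coef_mx (fun i => q i * (1 + 'X)).
  rewrite mulmxDr mulmx1 coef_mx_shift; apply/matrixP => i j.
  by rewrite !mxE mulrDr mulr1 coefD.
rewrite mulmxA !add1 mulmxDl mul1mx shift_coef_mx => [|j jr]; last first.
  by rewrite pi coefMXn jr.
apply/matrixP => i j; rewrite !mxE -coefD exprS.
have -> : p ^+ i + p * p ^+ i = p ^+ i * (1 + 'X) * (1 + 'X).
  by rewrite {2}/p polyC_natr; ring.
by [].
Qed.

End Shift.

Section JordanChain.
Variables (k : fieldType) (n : nat).
Implicit Types N : 'M[k]_n.+1.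

(** Let [r + 2] be the order of nilpotency of [N] and choose an entry [(a, b)]
    where [N ^+ r.+1] is nonzero.  The rows of [X] are the iterates under [N] of
    the [a]-th coordinate row, those of [Y] are columns iterated from the [b]-th
    one.  The pairing [X *m Y] is triangular with that entry on its diagonal,
    hence invertible, so [C *m X], for [C] the normalized [Y], is a projection
    commuting with [N] on whose image [N] is one Jordan block. *)
Lemma jordan_block_split N m : N ^+ m = 0 -> N != 0 ->
  exists r (X : 'M[k]_(r.+2, n.+1)) (C : 'M[k]_(n.+1, r.+2)),
    [/\ X *m C = 1%:M, X *m N = shift_mx k r.+2 *m X & N *m C = C *m shift_mx k r.+2].
Proof.
move=> Nm N0; have exN : exists m, N ^+ m == 0 by exists m; apply/eqP.
have [[|[|r]] /eqP Nr rmin] := ex_minnP exN.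
- by move/eqP: Nr; rewrite expr0 oner_eq0.
- by rewrite expr1 in Nr; rewrite Nr eqxx in N0.
have Nge i : (r.+2 <= i)%N -> N ^+ i = 0.
  by move=> /subnK<-; rewrite exprD Nr mulr0.
have : N ^+ r.+1 != 0 by apply/negP => /rmin; rewrite ltnn.
have [a [b Nab] _] : exists a b, (N ^+ r.+1) a b != 0.
  apply: contrapT => /forallNP H.
  have : N ^+ r.+1 == 0; last by move=> /rmin; rewrite ltnn.
  apply/eqP/matrixP => a b; rewrite mxE; apply/eqP/negPn/negP => Nab.
  by apply: (H a); exists b.
pose X : 'M[k]_(r.+2, n.+1) := \matrix_(i, j) (N ^+ i) a j.
pose Y : 'M[k]_(n.+1, r.+2) := \matrix_(i, j) (N ^+ (r.+1 - j)) i b.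
pose J := shift_mx k r.+2.
have XN : X *m N = J *m X.
  apply/matrixP => i j; rewrite !mxE.
  under eq_bigr do rewrite mxE.
  have -> : \sum_(l < n.+1) (N ^+ i) a l * N l j = (N ^+ i.+1) a j.
    by rewrite exprSr mxE.
  have [ir|ir] := ltnP i.+1 r.+2.
    rewrite (bigD1 (Ordinal ir)) //= !mxE eqxx mul1r big1 ?addr0 // => l.
    by rewrite -val_eqE /= !mxE => /negbTE->; rewrite mul0r.
  rewrite Nge // mxE big1 // => l _; rewrite !mxE (_ : _ == _ = false) ?mul0r //.
  by rewrite ltn_eqF // (leq_trans (ltn_ord l)).
have NY : N *m Y = Y *m J.
  apply/matrixP => i j; rewrite !mxE.
  under eq_bigr do rewrite mxE.
  have -> : \sum_(l < n.+1) N i l * (N ^+ (r.+1 - j)) l b = (N ^+ (r.+1 - j).+1) i b.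
    by rewrite exprS mxE.
  have [j0|j0] := posnP j.
    rewrite j0 subn0 Nge // mxE big1 // => l _.
    by rewrite !mxE j0 mulr0.
  have lj : (j.-1 < r.+2)%N by rewrite (leq_ltn_trans (leq_pred _)).
  rewrite (bigD1 (Ordinal lj)) //= !mxE /= prednK // eqxx mulr1 big1 ?addr0 //.
    by congr ((N ^+ _) i b); have := ltn_ord j; lia.
  move=> l; rewrite -val_eqE /= => lne; rewrite !mxE (_ : _ == _ = false) ?mulr0 //.
  by apply: contraNF lne => /eqP->.
pose G := X *m Y.
have GE i j : G i j = (N ^+ (i + (r.+1 - j))) a b.
  by rewrite exprD mxE mxE; apply: eq_bigr => l _; rewrite !mxE.
have uG : G \in unitmx.
  rewrite unitmxE -det_tr det_trig.
    rewrite unitfE; apply/prodf_neq0 => i _; rewrite mxE GE subnKC //.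
    by rewrite -ltnS.
  apply/is_trig_mxP => i j ij; rewrite mxE GE Nge ?mxE //.
  by have := ltn_ord i; lia.
have JG : J *m G = G *m J by rewrite /G mulmxA -XN -!mulmxA NY.
exists r, X, (Y *m invmx G); split=> //; first by rewrite mulmxA mulmxV.
rewrite mulmxA NY -!mulmxA; congr (_ *m _).
by apply: (can_inj (mulKmx uG)); rewrite !mulmxA -JG mulmxK // mulmxV // mul1mx.
Qed.

End JordanChain.

Section JordanChevalley.
Variables (k : fieldType).

(** Chinese remaindering, one residue at a time: powers of distinct linear
    factors are coprime, and a Bezout relation corrects the previous solution. *)
Lemma crt_constants (s : seq k) M : uniq s -> exists q : {poly k},
  forall a, a \in s -> ('X - a%:P) ^+ M %| q - a%:P.
Proof.
elim: s => [|a s IHs] /=; first by exists 0.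
move=> /andP[a_s /IHs[q qP]].
pose P := (\prod_(b <- s) ('X - b%:P)) ^+ M.
have : coprimep (('X - a%:P) ^+ M) P.
  apply/coprimep_expl/coprimep_expr; rewrite coprimep_sym coprimep_XsubC.
  by rewrite root_prod_XsubC.
move=> /Bezout_eq1_coprimepP[[u v] /= uv].
exists (q + (a%:P - q) * (v * P)) => b /[!inE] /predU1P[->|bs].
  apply/dvdpP; exists ((q - a%:P) * u).
  have -> : v * P = 1 - u * ('X - a%:P) ^+ M by rewrite -uv; ring.
  by ring.
rewrite addrAC dvdp_add ?qP // dvdp_mull // dvdp_mull //.
by rewrite dvdp_exp2r // (big_rem b) //= dvdp_mulr.
Qed.

(** Take [S = q(A)] with [q] congruent to the constant [z] modulo a high power
    of ['X - z%:P] for each eigenvalue [z].  The squarefree polynomial with these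
    roots annihilates [S], so [S] is diagonalizable; and ['X - q] is divisible by
    every ['X - z%:P], so [A - S] is nilpotent. *)
Lemma jordan_chevalley n (A : 'M[k]_n.+1) (rs : seq k) :
  char_poly A = \prod_(z <- rs) ('X - z%:P) ->
  exists S N m, [/\ A = S + N, N ^+ m = 0, diagonalizable S,
                    GRing.comm A S & GRing.comm A N].
Proof.
move=> chA; pose s := undup rs; pose m := (size rs).+1.
have [q qP] := crt_constants m (undup_uniq rs).
pose P := \prod_(a <- s) ('X - a%:P).
have chP : char_poly A %| P ^+ m.
  rewrite chA /m exprS dvdp_mull //.
  have : all (mem s) rs by apply/allP => a; rewrite inE /= mem_undup.
  elim: (rs) => [|a t IHt] /=; first by rewrite big_nil expr0 dvdpp.
  move=> /andP[ts /IHt tP]; rewrite big_cons exprS dvdp_mul //.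
  by rewrite /P (big_rem a) //= dvdp_mulr.
have ann p : P ^+ m %| p -> horner_mx A p = 0.
  move=> /(dvdp_trans chP)/dvdpP[c ->]; rewrite rmorphM /=.
  by rewrite (Cayley_Hamilton A) mulr0.
exists (horner_mx A q), (horner_mx A ('X - q)), m; split.
- rewrite -rmorphD (_ : q + ('X - q) = 'X); last by ring.
  exact: (esym (horner_mx_X A)).
- rewrite -rmorphXn; apply: ann; apply: dvdp_exp2r; apply: uniq_roots_dvdp.
    apply/allP => a /qP qa; rewrite -dvdp_XsubCl.
    have -> : 'X - q = ('X - a%:P) - (q - a%:P) by ring.
    by rewrite dvdp_sub ?dvdpp // (dvdp_trans _ qa) // dvdp_exp.
  by rewrite uniq_rootsE undup_uniq.
- apply/diagonalizableP; exists s; first exact: undup_uniq.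
  apply: mxminpoly_min; rewrite rmorph_prod /=.
  have -> : \prod_(a <- s) horner_mx (horner_mx A q) ('X - a%:P) =
            horner_mx A (\prod_(a <- s) (q - a%:P)).
    rewrite rmorph_prod; apply: eq_bigr => a _.
    by rewrite !rmorphB /= !horner_mx_X !horner_mx_C.
  apply: ann; rewrite /P -prodrXl big_seq [X in _ %| X]big_seq.
  by elim/big_rec2: _ => [|a x y as_ xy]; rewrite ?dvdpp // dvdp_mul // qP.
- by apply: comm_mx_horner; apply: comm_mx_refl.
- by apply: comm_mx_horner; apply: comm_mx_refl.
Qed.

End JordanChevalley.

(** * Lengths of matrices *)

Import Order.TTheory Num.Theory.

Section MatrixLength.
Variables (k : closedFieldType) (n : nat) (R : realFieldType).
Variable L : 'M[k]_n.+1 -> R.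
Implicit Types A B N P : 'M[k]_n.+1.

Hypothesis L_ge0 : forall A, 0 <= L A.
Hypothesis LX : forall A m, A \is a GRing.unit -> L (A ^+ m) = m%:R * L A.
Hypothesis LJ : forall P A B, P \is a GRing.unit -> A \is a GRing.unit ->
  B \is a GRing.unit -> P * A = B * P -> L A = L B.
Hypothesis L_comm : forall A B, A \is a GRing.unit -> B \is a GRing.unit ->
  GRing.comm A B -> L (A * B) <= L A + L B.
Hypothesis L_diag : forall d : 'rV_n.+1, diag_mx d \is a GRing.unit -> L (diag_mx d) = 0.

Lemma mxlength_mul_eq0 A B : A \is a GRing.unit -> B \is a GRing.unit ->
  GRing.comm A B -> L A = 0 -> L B = 0 -> L (A * B) = 0.
Proof.
move=> uA uB cAB A0 B0; apply/eqP; rewrite eq_le L_ge0 andbT.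
by apply: le_trans (L_comm uA uB cAB) _; rewrite A0 B0 addr0.
Qed.

Lemma mxlength1 : L 1 = 0.
Proof. by have := LX 2 (unitr1 _); rewrite expr1n => ?; lra. Qed.

(** Here squaring is additive on commuting matrices, so [1 + N] has finite
    order. *)
Lemma mxlength_unipotent_char2 N m : 2%:R = 0 :> k -> N ^+ m = 0 -> L (1 + N) = 0.
Proof.
move=> two Nm; have u1N := unit_1add_nilpotent Nm.
have frob j : (1 + N) ^+ (2 ^ j) = 1 + N ^+ (2 ^ j).
  elim: j => [|j IHj]; first by rewrite !expn0 !expr1.
  rewrite expnSr !exprM IHj; move: (N ^+ _) => M.
  have MM : M + M = 0 by rewrite -mulr2n -scaler_nat two scale0r.
  by rewrite expr2 mulrDl mul1r mulrDr mulr1 -addrA [M + (M + _)]addrA MM add0r.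
have Lpow := LX (2 ^ m) u1N; move: Lpow; rewrite frob.
have -> : N ^+ (2 ^ m) = 0.
  by rewrite -(subnK (ltnW (ltn_expl m (ltnSn 1)))) exprD Nm mulr0.
rewrite addr0 mxlength1 => /esym/eqP; rewrite mulf_eq0 => /orP[|/eqP//].
by rewrite pnatr_eq0 expn_eq0.
Qed.

Lemma mxlength_square_conj P A : P \is a GRing.unit -> A \is a GRing.unit ->
  P * (A * A) = A * P -> L A = 0.
Proof.
move=> uP uA PA; have uAA : A * A \is a GRing.unit by rewrite unitrMl.
have := LX 2 uA; rewrite expr2 (LJ uP uAA uA PA) => ?; lra.
Qed.

Section Embed.
Variables (r : nat) (X : 'M[k]_(r, n.+1)) (C : 'M[k]_(n.+1, r)).
Hypothesis XC : X *m C = 1%:M.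

(** The matrix acting as [T] on the image of the projection [C *m X] and as the
    identity on its kernel. *)
Definition embed_block (T : 'M[k]_r) : 'M[k]_n.+1 := 1 - C *m X + C *m T *m X.

Lemma embed_blockM S T : embed_block (S *m T) = embed_block S * embed_block T.
Proof.
have CXX U : (1 - C *m X) * (C *m U *m X) = 0.
  rewrite mulrBl mul1r -[_ * _]/(_ *m _) !mulmxA -(mulmxA C X C) XC mulmx1 subrr //.
have XXC U : (C *m U *m X) * (1 - C *m X) = 0.
  rewrite mulrBr mulr1 -[_ * _]/(_ *m _) !mulmxA -(mulmxA _ X C) XC mulmx1 subrr //.
rewrite /embed_block; set e := 1 - _ in CXX XXC *.
have orth a b : e * b = 0 -> a * e = 0 -> (e + a) * (e + b) = e * e + a * b.
  move: (e) => f fb af; by rewrite mulrDl !mulrDr fb af addr0 add0r.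
rewrite (orth _ _ (CXX T) (XXC S)); congr (_ + _).
  rewrite {2}/e mulrBr mulr1 -[e * _]/(e *m _) /e mulmxBl mul1mx !mulmxA.
  by rewrite -(mulmxA C X C) XC mulmx1 subrr subr0.
by rewrite -[_ * _]/(_ *m _) !mulmxA -(mulmxA _ X C) XC mulmx1.
Qed.

Lemma embed_block1 : embed_block 1%:M = 1.
Proof. by rewrite /embed_block mulmx1 subrK. Qed.

Lemma embed_block_unit T : T \in unitmx -> embed_block T \is a GRing.unit.
Proof.
move=> uT; apply/unitrP; exists (embed_block (invmx T)).
by rewrite -!embed_blockM mulmxV ?mulVmx ?embed_block1.
Qed.

End Embed.

(** Split off one Jordan block [N1] of [N].  The remainder [N2] has smaller rank
    and annihilates [N1] on both sides, so [1 + N] is the product of the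
    commuting [1 + N1] and [1 + N2]. *)
Lemma mxlength_unipotent N m : N ^+ m = 0 -> L (1 + N) = 0.
Proof.
have [two|two] := eqVneq (2%:R : k) 0; first exact: mxlength_unipotent_char2.
have [d] := ubnP (\rank N); elim: d N m => // d IHd N m; rewrite ltnS => rN Nm.
have [->|N0] := eqVneq N 0; first by rewrite addr0 mxlength1.
have [r [X [C [XC XN NC]]]] := jordan_block_split Nm N0.
set J := shift_mx _ _ in XN NC.
pose N1 := C *m J *m X; pose N2 := N - N1.
have N11 : N1 * N1 = N1 * N.
  rewrite /N1 -![_ * _]/(_ *m _) -!mulmxA XN; congr (C *m (J *m _)).
  by rewrite !mulmxA XC mul1mx.
have N1N : N1 * N = N * N1.
  by rewrite /N1 -![_ * _]/(_ *m _) !mulmxA NC -!mulmxA XN !mulmxA.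
have N1N2 : N1 * N2 = 0 by rewrite mulrBr N11 subrr.
have N2N1 : N2 * N1 = 0 by rewrite mulrBl N11 N1N subrr.
have nil1 i : N1 ^+ i.+1 = N1 * N ^+ i.
  by elim: i => [|i IHi]; rewrite ?expr1 ?mulr1 // exprS IHi mulrA N11 -mulrA -exprS.
have nil2 i : N2 ^+ i.+1 = N2 * N ^+ i.
  elim: i => [|i IHi]; first by rewrite expr1 mulr1.
  rewrite exprS IHi mulrA (_ : N2 * N2 = N2 * N) -?mulrA -?exprS //.
  by rewrite {2}/N2 mulrBr N2N1 subr0.
have N1m : N1 ^+ m.+1 = 0 by rewrite nil1 Nm mulr0.
have N2m : N2 ^+ m.+1 = 0 by rewrite nil2 Nm mulr0.
have u1 := unit_1add_nilpotent N1m; have u2 := unit_1add_nilpotent N2m.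
have -> : 1 + N = (1 + N1) * (1 + N2).
  by rewrite mulrDl mul1r mulrDr mulr1 N1N2 addr0 -addrA subrK.
apply: mxlength_mul_eq0 => //.
- apply: commrD; first exact: commr1.
  by apply/commr_sym/commrD; [exact: commr1 | rewrite /GRing.comm N1N2 N2N1].
- have [Q uQ QJ] := @jordan_block_sqr_conj k r.+2 two.
  have E1 : 1 + N1 = embed_block X C (1%:M + J).
    by rewrite /embed_block mulmxDr mulmx1 mulmxDl addrA subrK.
  apply: (@mxlength_square_conj (embed_block X C Q)) => //; first exact: embed_block_unit.
  by rewrite E1 -!embed_blockM // QJ.
apply: IHd N2m; apply: leq_trans rN.
(* The row space of [N2] lies in that of [N]; it is strictly smaller because [N2]
   kills [C] while [N] does not. *)
have N2E : N2 = (1%:M - C *m X) *m N.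
  by rewrite mulmxBl mul1mx -mulmxA XN mulmxA.
apply: rank_ltmx; rewrite ltmxE {1}N2E submxMl /=; apply/negP => /submxP[D ND].
have N2C : N2 *m C = 0 by rewrite mulmxBl NC /N1 -(mulmxA _ X C) XC mulmx1 subrr.
have : J = 0.
  by rewrite -[J]mul1mx -XC -mulmxA -NC ND -mulmxA N2C !mulmx0.
move/matrixP/(_ ord0 (Ordinal (isT : 1 < r.+2)%N)); rewrite !mxE /= => /eqP.
by rewrite oner_eq0.
Qed.

(** The Jordan-Chevalley decomposition reduces to the diagonal and the
    unipotent case. *)
Lemma mxlength_eq0 A : A \is a GRing.unit -> L A = 0.
Proof.
move=> uA.
have [rs] := closed_field_poly_normal (char_poly A).
rewrite (monicP (char_poly_monic A)) scale1r => chA.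
have [S [N [m [AE Nm dS cAS cAN]]]] := jordan_chevalley chA.
have uS : S \is a GRing.unit.
  have -> : S = A * (1 - A^-1 * N) by rewrite mulrBr mulr1 mulrA divrr // mul1r AE addrK.
  rewrite unitrMr //; apply: (@unit_1sub_nilpotent _ _ m).
  rewrite exprMn_comm ?Nm ?mulr0 //.
  exact/commr_sym/commrV/commr_sym.
have cSN : GRing.comm S N.
  have -> : N = A - S by rewrite AE addrC addKr.
  by apply: commrB; [exact: commr_sym | exact: commr_refl].
have nil : (S^-1 * N) ^+ m = 0.
  rewrite exprMn_comm ?Nm ?mulr0 //; exact/commr_sym/commrV/commr_sym.
have -> : A = S * (1 + S^-1 * N) by rewrite mulrDr mulr1 mulrA divrr // mul1r.
apply: mxlength_mul_eq0 => //.
- exact: unit_1add_nilpotent nil.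
- apply: commrD; first exact: commr1.
  by apply: commrM => //; apply/commrV/commr_refl.
- have [P uP /diagonalizable_forPex[d /(simmxP uP) PS]] := dS.
  have uD : diag_mx d \is a GRing.unit.
    have -> : diag_mx d = P * S * P^-1 by rewrite -[P * S]/(P *m S) PS mulrK.
    by rewrite unitrMl ?unitrV // unitrMr.
  by rewrite (LJ uP uS uD PS) L_diag.
- exact: mxlength_unipotent nil.
Qed.

End MatrixLength.

(** * Lengths on the Cremona group *)

(** The projective class of an invertible matrix; singular matrices get the
    identity.  Locking keeps unification from comparing quotient classes when
    it should compare matrices. *)
HB.lock Definition lin_class (k : fieldType) (n : nat) (A : 'M[k]_n.+1) : Bir k n :=
  \pi_(Bir k n) (insubd (mk_birep (birational_id k n)) (lin_forms A)).

Section LinearClass.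
Variables (k : fieldType) (n : nat).
Implicit Types A B : 'M[k]_n.+1.

Lemma lin_classE A (b : birep k n) : A \is a GRing.unit ->
  birep_forms b = lin_forms A -> lin_class A = \pi_(Bir k n) b.
Proof.
move=> uA bA; rewrite lin_class.unlock; apply/Bir_eqP.
rewrite bA -[birep_forms _]/(val _) insubdK.
  exact: proportional_refl.
exact/asboolP/birational_lin.
Qed.

Lemma lin_class_unit A (uA : A \in unitmx) :
  lin_class A = \pi_(Bir k n) (mk_birep (birational_lin uA)).
Proof. exact: lin_classE. Qed.

Lemma lin_classM A B : A \is a GRing.unit -> B \is a GRing.unit ->
  lin_class (A * B) = (lin_class A * lin_class B)%g.
Proof.
move=> uA uB; have uAB : A * B \is a GRing.unit by rewrite unitrMr.
rewrite (lin_class_unit uA) (lin_class_unit uB) (lin_class_unit uAB).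
by apply/esym/Bir_mulE; rewrite /= lin_formsM.
Qed.

Lemma lin_class1 : lin_class (1 : 'M[k]_n.+1) = 1%g.
Proof.
by apply: (lin_classE (b := mk_birep (birational_id k n))); rewrite ?unitr1 ?lin_forms1.
Qed.

Lemma lin_classX A m : A \is a GRing.unit -> lin_class (A ^+ m) = (lin_class A ^+ m)%g.
Proof.
move=> uA; elim: m => [|m IHm]; first exact: lin_class1.
by rewrite exprS expgS lin_classM ?unitrX // IHm.
Qed.

End LinearClass.

Section Cremona.
Variables (k : fieldType) (n m : nat).
Implicit Types (i j z : 'I_n.+1) (a : k).

(** In affine coordinates with denominator [X_z]: the coordinate [X_j] is
    multiplied by the [m]-th power of the coordinate [X_i], the others are kept.
    Exchanging [i] and [z] gives the inverse map. *)
Definition cremona i z j : n.+1.-tuple {mpoly k[n.+1]} :=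
  [tuple (if l == j then 'X_i else 'X_z) ^+ m * 'X_l | l < n.+1].

Lemma ratmap_cremona i z j : is_ratmap (cremona i z j).
Proof.
have X0 l : 'X_l != 0 :> {mpoly k[n.+1]} by rewrite -msize_poly_eq0 msizeX mdeg1.
have X1 l : 'X_l \is [in k[n.+1], 1.-homog] by rewrite dhomogX /= mdeg1.
split.
  exists (1 * m + 1)%N => l; rewrite tnth_mktuple; apply: dhomogM => //.
  by apply: dhomogMn; case: ifP.
by exists j; rewrite tnth_mktuple mulf_neq0 // expf_neq0 //; case: ifP.
Qed.

Lemma cremonaK i z j l : i != j -> z != j ->
  tnth (comp_forms (cremona i z j) (cremona z i j)) l =
  'X_i ^+ (m * m + m) * 'X_z ^+ m * 'X_l.
Proof.
move=> ij zj; rewrite !tnth_mktuple rmorphM rmorphXn /=.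
rewrite (fun_if (comp_mpoly _)) !comp_mpolyXU -!tnth_nth !tnth_mktuple.
rewrite (negbTE ij) (negbTE zj) exprD exprM.
by case: ifP => _; rewrite exprMn; ring.
Qed.

Lemma birational_cremona i z j : i != j -> z != j -> birational (cremona i z j).
Proof.
move=> ij zj; split; first exact: ratmap_cremona.
exists (cremona z i j); first exact: ratmap_cremona.
have inv i' z' : i' != j -> z' != j ->
    is_ratmap (comp_forms (cremona i' z' j) (cremona z' i' j)) /\
    proportional (comp_forms (cremona i' z' j) (cremona z' i' j)) (id_forms k n).
  move=> ij' zj'; split; last first.
    by apply/proportionalP => p q; rewrite !cremonaK // !tnth_mktuple; ring.
  have [[d hd] _] := ratmap_cremona i' z' j.
  have [[e he] _] := ratmap_cremona z' i' j; split.
    by exists (e * d)%N => l; rewrite tnth_mktuple; apply: comp_mpoly_homog.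
  exists j; rewrite cremonaK // !mulf_neq0 ?expf_neq0 //;
    by rewrite -msize_poly_eq0 msizeX mdeg1.
by have [? ?] := inv i z ij zj; have [? ?] := inv z i zj ij; split.
Qed.

Lemma comp_lin_diag (d : 'rV[k]_n.+1) f l :
  tnth (comp_forms (lin_forms (diag_mx d)) f) l = d 0 l *: tnth f l.
Proof.
rewrite !tnth_mktuple (bigD1 l) //= big1 => [|q ql].
  by rewrite addr0 mxE eqxx comp_mpolyZ comp_mpolyXU -tnth_nth.
by rewrite mxE eq_sym (negbTE ql) scale0r.
Qed.

Definition diag1 i a : 'rV[k]_n.+1 := \row_l if l == i then a else 1.

(** Scaling [X_i] by [a] scales the monomial of index [j] by [a ^+ m] in addition
    and leaves the power of [X_z] alone. *)
Lemma cremona_diag i z j a : i != j -> z != i ->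
  comp_forms (cremona i z j) (lin_forms (diag_mx (diag1 i a))) =
  comp_forms (lin_forms (diag_mx (diag1 i a) * diag_mx (diag1 j a) ^+ m))
             (cremona i z j).
Proof.
move=> ij zi.
have lin_diag (d : 'rV[k]_n.+1) l : tnth (lin_forms (diag_mx d)) l = d 0 l *: 'X_l.
  by rewrite -[lin_forms _]comp_forms1 comp_lin_diag tnth_mktuple.
have -> : diag_mx (diag1 i a) * diag_mx (diag1 j a) ^+ m =
    diag_mx (\row_l ((diag1 i a) 0 l * (diag1 j a) 0 l ^+ m)).
  elim: m => [|p IHp].
    by rewrite mulr1; congr diag_mx; apply/rowP => l; rewrite !mxE mulr1.
  rewrite exprSr mulrA IHp -[_ * _]/(_ *m _) mulmx_diag; congr diag_mx.
  by apply/rowP => l; rewrite !mxE exprSr mulrA.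
apply/eq_from_tnth => l; rewrite comp_lin_diag !tnth_mktuple rmorphM rmorphXn /=.
rewrite (fun_if (comp_mpoly _)) !comp_mpolyXU -!tnth_nth !lin_diag !mxE eqxx.
rewrite (negbTE zi); have [->|lj] := eqVneq l j.
  rewrite eq_sym (negbTE ij) !scale1r mul1r exprZn -scalerAl //.
by rewrite !scale1r expr1n mulr1 -scalerAr.
Qed.

End Cremona.

Section LengthVanishes.
Variables (k : closedFieldType) (n : nat) (R : realType) (l : Bir k n -> R).
Hypothesis n_ge2 : (2 <= n)%N.
Hypothesis hl : length_function l.

Local Notation L A := (l (lin_class A)).

Lemma length_ge0 g : 0 <= l g.
Proof. by have [h _ _ _] := hl. Qed.

Lemma length_expg g m : l (g ^+ m)%g = m%:R * l g.
Proof. by have [_ h _ _] := hl; have := h g (Posz m). Qed.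

Lemma length_invg g : l (g^-1)%g = l g.
Proof.
have [_ h _ _] := hl; have := h g (Negz 0).
by rewrite (_ : `|Negz 0| = 1 :> int) // mul1r.
Qed.

Lemma length_conj t g h : (t * g)%g = (h * t)%g -> l g = l h.
Proof.
move=> e; have [_ _ lJ _] := hl; rewrite -(lJ g t) e.
by rewrite mulgK.
Qed.

Lemma length_commute g h : (g * h)%g = (h * g)%g -> l (g * h)%g <= l g + l h.
Proof. by have [_ _ _ lC] := hl => /lC. Qed.

Lemma diag_unitP (d : 'rV[k]_n.+1) :
  reflect (forall i, d 0 i != 0) (diag_mx d \is a GRing.unit).
Proof.
rewrite -[X in reflect _ X]/(diag_mx d \in unitmx) unitmxE det_diag unitfE.
apply: (iffP idP) => [/prodf_neq0 d0 i|d0]; first exact: d0.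
by apply/prodf_neq0.
Qed.

Lemma diag1_unit i (a : k) : a != 0 -> diag_mx (diag1 (n := n) i a) \is a GRing.unit.
Proof.
by move=> a0; apply/diag_unitP => q; rewrite mxE; case: ifP; rewrite ?oner_neq0.
Qed.

Lemma diag_comm (d e : 'rV[k]_n.+1) : GRing.comm (diag_mx d) (diag_mx e).
Proof.
rewrite /GRing.comm -![_ * _]/(_ *m _) !mulmx_diag; congr diag_mx.
by apply/rowP => q; rewrite !mxE mulrC.
Qed.

(** The conjugation by the monomial map of exponent 3 gives [D i a] and
    [D i a * D j a ^ 3] the same length.  Exponent 3 exceeds the factor 2 that is
    lost in dividing by [D i a], so that the inequality and its mirror image
    force both lengths to vanish. *)
Lemma length_diag1_le i j (a : k) : i != j -> a != 0 ->
  3%:R * L (diag_mx (diag1 j a)) <= 2%:R * L (diag_mx (diag1 i a)).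
Proof.
move=> ij a0.
have [z /andP[zi zj]] : exists z : 'I_n.+1, (z != i) && (z != j).
  apply/existsP; rewrite -[[exists _, _]]negbK negb_exists; apply/negP => /forallP H.
  have : (#|[set: 'I_n.+1]| <= #|[set i; j]|)%N.
    apply/subset_leq_card/subsetP => z _; rewrite !inE.
    by have := H z; rewrite negb_and !negbK.
  by rewrite cardsT card_ord cards2 ij; lia.
have ui := diag1_unit i a0; have uj := diag1_unit j a0.
set Di := diag_mx (diag1 i a) in ui *; set Dj := diag_mx (diag1 j a) in uj *.
have uj3 : Dj ^+ 3 \is a GRing.unit by rewrite unitrX.
have conj : L Di = l (lin_class Di * lin_class Dj ^+ 3)%g.
  rewrite -(lin_classX 3 uj) -(lin_classM ui uj3).
  pose t := mk_birep (birational_cremona k 3 ij zj).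
  apply: (@length_conj (\pi_(Bir k n) t)).
  have uDD : Di * Dj ^+ 3 \is a GRing.unit by rewrite unitrMr.
  rewrite (lin_class_unit ui) (lin_class_unit uDD).
  transitivity (\pi_(Bir k n) (mk_birep (birational_comp (birepP t)
    (birational_lin ui)))); first by apply: Bir_mulE.
  by apply/esym/Bir_mulE; rewrite /= cremona_diag.
have -> : 3%:R * L Dj = l ((lin_class Di)^-1 * (lin_class Di * lin_class Dj ^+ 3))%g.
  by rewrite mulKg length_expg.
have cDD : commute (lin_class Di) (lin_class Dj).
  by rewrite /commute -(lin_classM ui uj) -(lin_classM uj ui) diag_comm.
apply: le_trans (length_commute _) _.
  by rewrite mulKg (commuteX 3 cDD) mulgK.
rewrite length_invg -conj; lra.
Qed.

Lemma length_diag1 i (a : k) : a != 0 -> L (diag_mx (diag1 i a)) = 0.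
Proof.
move=> a0; have [j ij] : exists j : 'I_n.+1, i != j.
  have [->|i0] := eqVneq i ord0; last by exists ord0.
  by exists ord_max; rewrite -val_eqE /= ltn_eqF // ltnW.
have lij := length_diag1_le ij a0; rewrite eq_sym in ij.
have lji := length_diag1_le ij a0.
by have := length_ge0 (lin_class (diag_mx (diag1 i a))); lra.
Qed.

Lemma length_matrix_comm (A B : 'M[k]_n.+1) :
  A \is a GRing.unit -> B \is a GRing.unit -> GRing.comm A B ->
  L (A * B) <= L A + L B.
Proof.
move=> uA uB cAB; rewrite (lin_classM uA uB); apply: length_commute.
by rewrite -(lin_classM uA uB) -(lin_classM uB uA) cAB.
Qed.

Lemma length_diag (d : 'rV[k]_n.+1) : diag_mx d \is a GRing.unit -> L (diag_mx d) = 0.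
Proof.
move=> /diag_unitP d0.
pose e m : 'rV[k]_n.+1 := \row_q if (q < m)%N then d 0 q else 1.
have ue m : diag_mx (e m) \is a GRing.unit.
  by apply/diag_unitP => q; rewrite mxE; case: ifP; rewrite ?oner_neq0.
have -> : d = e n.+1 by apply/rowP => q; rewrite mxE ltn_ord.
suff zero m : (m <= n.+1)%N -> L (diag_mx (e m)) = 0 by apply: zero.
elim: m => [_|m IHm mn].
  have -> : diag_mx (e 0) = 1.
    rewrite -[RHS]/(1%:M) -diag_const_mx; congr diag_mx.
    by apply/rowP => q; rewrite !mxE.
  by rewrite lin_class1; have := length_expg 1%g 0; rewrite mul0r.
pose i : 'I_n.+1 := Ordinal mn.
have eE : diag_mx (e m.+1) = diag_mx (e m) * diag_mx (diag1 i (d 0 i)).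
  rewrite -[_ * _]/(_ *m _) mulmx_diag; congr diag_mx; apply/rowP => q.
  rewrite !mxE ltnS -val_eqE /=; case: (ltngtP q m) => [_|_|qm]; rewrite ?mulr1 //.
  by rewrite mul1r; congr (d 0 _); apply: val_inj.
apply/eqP; rewrite eq_le length_ge0 andbT eE.
apply: le_trans (length_matrix_comm (ue m) (diag1_unit i (d0 i)) (diag_comm _ _)) _.
by rewrite (IHm (ltnW mn)) length_diag1 // addr0.
Qed.

Lemma length_linear (A : 'M[k]_n.+1) : A \is a GRing.unit -> L A = 0.
Proof.
apply: (@mxlength_eq0 k n R (fun B => L B)).
- by move=> B; apply: length_ge0.
- by move=> B m uB; rewrite (lin_classX m uB) length_expg.
- move=> P B C uP uB uC e; apply: (@length_conj (lin_class P)).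
  by rewrite -(lin_classM uP uB) -(lin_classM uC uP) e.
- exact: length_matrix_comm.
- exact: length_diag.
Qed.

End LengthVanishes.

Theorem theorem0p10 (k : closedFieldType) (n : nat) (n_ge2 : (2 <= n)%N) :
  (forall phi : Bir k n, biregular phi <-> projective_linear phi) /\
  (forall (R : realType) (l : Bir k n -> R), length_function l ->
     forall phi : Bir k n, biregular phi -> l phi = 0).
Proof.
have bP (phi : Bir k n) : biregular phi <-> projective_linear phi.
  split; last exact: projective_linear_biregular.
  by apply: biregular_projective_linear; apply: ltnW.
split=> // R l hl phi /bP[A uA [b bA <-]].
by rewrite -(lin_classE uA bA) (length_linear n_ge2 hl).
Qed.
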